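(* Let $n \geq 4$ and $2 \leq k \leq n-2$. Then there exists an infinitely smooth centrally-symmetric body of revolution $K$ in $\mathbb{R}^n$ such that $K \in \mathcal{I}_k^n$ but $K \notin \mathcal{BP}_k^n$.
   Context: A centrally-symmetric star-body $K\subset\mathbb{R}^n$ is a compact set with non-empty interior such that $K=-K$, $tK\subset K$ for all $t\in[0,1]$, and such that its radial function $\rho_K(\theta)=\max\{r\ge 0 : r\theta\in K\}$, $\theta\in S^{n-1}$, is an even continuous function on $S^{n-1}$. All bodies considered are centrally-symmetric star-bodies. $K$ is infinitely smooth if $\rho_K$ is infinitely smooth on $S^{n-1}$. $K$ is a body of revolution if $\rho_K$ is invariant under the natural action of $O(n-1)$ identified as some subgroup of $O(n)$ (namely the subgroup of $O(n)$ fixing some $\xi_0\in S^{n-1}$). The radial metric is $d_r(K_1,K_2)=\sup_{\theta\in S^{n-1}}|\rho_{K_1}(\theta)-\rho_{K_2}(\theta)|$. $G(n,m)$ denotes the Grassmann manifold of $m$-dimensional linear subspaces of $\mathbb{R}^n$, and $\mathrm{Vol}(L)$ is the Lebesgue measure of $L$ in its affine hull. The class $\mathcal{I}_k^n$ ($k$-intersection bodies): a star-body $K$ is a $k$-intersection body of a star-body $L$ if $\mathrm{Vol}(K\cap H^\perp)=\mathrm{Vol}(L\cap H)$ for every $H\in G(n,n-k)$. $K$ is a $k$-intersection body ($K\in\mathcal{I}_k^n$) if it is the limit in the radial metric of $k$-intersection bodies $\{K_i\}$ of star-bodies $\{L_i\}$. The class $\mathcal{BP}_k^n$ ($k$-Busemann-Petty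 bodies): for $f\in C(S^{n-1})$ and $E\in G(n,m)$ let $R_m(f)(E)=\int_{S^{n-1}\cap E} f\,d\sigma_E$, where $\sigma_E$ is the Haar (rotation-invariant) probability measure on $S^{n-1}\cap E$. The dual transform $R_m^*$ from signed Borel measures on $G(n,m)$ to signed Borel measures on $S^{n-1}$ is defined by $\int_{S^{n-1}} f\,R_m^*(d\mu)=\int_{G(n,m)}R_m(f)\,d\mu$ for all $f\in C(S^{n-1})$. A star-body $K$ belongs to $\mathcal{BP}_k^n$ if $\rho_K^k=R_{n-k}^*(d\mu)$ as measures on $S^{n-1}$ for some non-negative Borel measure $\mu$ on $G(n,n-k)$, where $\rho_K^k$ is identified with the measure having density $\rho_K^k$ with respect to the Haar probability measure on $S^{n-1}$. *)

(* Defs.v *)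
From HB Require Import structures.
From mathcomp Require Import all_boot all_order all_algebra.
From mathcomp Require Import all_classical all_reals all_analysis.
Import Order.TTheory GRing.Theory Num.Theory.
Import numFieldNormedType.Exports.

Set Implicit Arguments.
Unset Strict Implicit.
Unset Printing Implicit Defensive.

Local Open Scope classical_set_scope.
Local Open Scope ring_scope.

(* R^n is 'rV[R]_n.  The library norm on 'rV[R]_n is the sup norm: it is used
   only for the topology; Euclidean lengths and angles go through x *m y^T. *)

Definition sphere (R : realType) (n : nat) : set 'rV[R]_n :=
  [set x | x *m x^T = 1%:M].
Arguments sphere : clear implicits.

Definition orthogonal_mx (R : realType) (n : nat) (U : 'M[R]_n) : Prop :=
  U *m U^T = 1%:M.

Definition radial (R : realType) (n : nat) (K : set 'rV[R]_n)
    (theta : 'rV[R]_n) : R :=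
  sup [set r : R | 0 <= r /\ K (r *: theta)].

Definition star_body (R : realType) (n : nat) (K : set 'rV[R]_n) : Prop :=
  [/\ compact K,
      K° !=set0,
      [set - x | x in K] = K,
      (forall t : R, 0 <= t <= 1 -> [set t *: x | x in K] `<=` K) &
      (forall theta, sphere R n theta -> radial K (- theta) = radial K theta) /\
      {within sphere R n, continuous (radial K)}].

Fixpoint iter_partial (R : realType) (n : nat) (s : seq 'I_n)
    (f : 'rV[R]_n -> R) : 'rV[R]_n -> R :=
  if s is i :: s' then 'D_(delta_mx 0 i) (iter_partial s' f) else f.

(* C^oo on U, meaningful for open U. *)
Definition smooth_on (R : realType) (n : nat) (U : set 'rV[R]_n)
    (f : 'rV[R]_n -> R) : Prop :=
  forall (s : seq 'I_n) (x : 'rV[R]_n), U x ->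
    {for x, continuous (iter_partial s f)} /\
    forall i : 'I_n, derivable (iter_partial s f) x (delta_mx 0 i).

(* C^oo functions on the submanifold S^{n-1}: those that locally extend to
   C^oo functions on open subsets of R^n. *)
Definition smooth_on_sphere (R : realType) (n : nat) (f : 'rV[R]_n -> R) :
    Prop :=
  forall theta, sphere R n theta ->
    exists (U : set 'rV[R]_n) (g : 'rV[R]_n -> R),
      [/\ open U, U theta, smooth_on U g &
          forall x, U x -> sphere R n x -> g x = f x].

Definition infinitely_smooth (R : realType) (n : nat) (K : set 'rV[R]_n) :
    Prop :=
  smooth_on_sphere (radial K).

Definition body_of_revolution (R : realType) (n : nat) (K : set 'rV[R]_n) :
    Prop :=
  exists2 xi0, sphere R n xi0 &
    forall U : 'M[R]_n, orthogonal_mx U -> xi0 *m U = xi0 ->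
      forall theta, sphere R n theta -> radial K (theta *m U) = radial K theta.

Definition radial_dist (R : realType) (n : nat) (K1 K2 : set 'rV[R]_n) : R :=
  sup [set `|radial K1 theta - radial K2 theta| | theta in sphere R n].

(* An m-dimensional subspace E of R^n is represented by the orthogonal
   projection P onto E, so that G(n,m) is a compact subset of 'M[R]_n carrying
   its usual topology; E is the row space of P and 1%:M - P represents the
   orthogonal complement of E. *)
Definition grassmannian (R : realType) (n m : nat) : set 'M[R]_n :=
  [set P | [/\ P^T = P, P *m P = P & \rank P = m]].
Arguments grassmannian : clear implicits.

Definition subspace_of (R : realType) (n : nat) (P : 'M[R]_n) :
    set 'rV[R]_n :=
  [set x | x *m P = x].

Definition orthocompl (R : realType) (n : nat) (P : 'M[R]_n) : 'M[R]_n :=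
  1%:M - P.

(* m-dimensional Lebesgue measure, as the product of the one-dimensional
   Lebesgue measure with the (m-1)-dimensional one; the integrand below is the
   measure of the section of A at first coordinate t. *)
Fixpoint volume (R : realType) (m : nat) : set 'rV[R]_m -> \bar R :=
  match m return set 'rV[R]_m -> \bar R with
  | 0 => fun A => (\1_A 0)%:E
  | m'.+1 => fun A =>
      (\int[@lebesgue_measure R]_t
         volume [set y : 'rV[R]_m' | A (row_mx (t%:M : 'M[R]_1) y)])%E
  end.

(* The rows of B form an orthonormal basis of the range of the projection P. *)
Definition is_orthonormal_basis (R : realType) (n m : nat) (P : 'M[R]_n)
    (B : 'M[R]_(m, n)) : Prop :=
  B *m B^T = 1%:M /\ B^T *m B = P.

(* Lebesgue measure of a subset of the m-dimensional subspace P, in the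
   coordinates of an orthonormal basis of P; the value does not depend on the
   basis. *)
Definition subspace_volume (R : realType) (n m : nat) (P : 'M[R]_n)
    (A : set 'rV[R]_n) : \bar R :=
  let B : 'M[R]_(m, n) := xget 0 [set B | is_orthonormal_basis P B] in
  volume [set y : 'rV[R]_m | A (y *m B)].

Definition intersection_body_of (R : realType) (n k : nat)
    (K L : set 'rV[R]_n) : Prop :=
  forall H : 'M[R]_n, grassmannian R n (n - k) H ->
    subspace_volume k (orthocompl H) (K `&` subspace_of (orthocompl H)) =
    subspace_volume (n - k) H (L `&` subspace_of H).

Definition intersection_bodies (R : realType) (n k : nat) :
    set (set 'rV[R]_n) :=
  [set K | star_body K /\
    exists Ks Ls : nat -> set 'rV[R]_n,
      (forall i, [/\ star_body (Ks i), star_body (Ls i) &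
                     intersection_body_of k (Ks i) (Ls i)]) /\
      radial_dist (Ks i) K @[i --> \oo] --> (0 : R)].
Arguments intersection_bodies : clear implicits.

Definition borel_mx (R : realType) (p q : nat) :=
  g_sigma_algebraType (@open 'M[R]_(p, q)).

(* Borel measures on S^{n-1}, on S^{n-1} `&` E and on G(n,m) are represented
   by Borel measures on the ambient space R^n or 'M[R]_n; integrals against
   them are always taken over the closed subset in question, and hence only
   involve the restriction of the measure to that subset. *)

Definition is_haar_sphere (R : realType) (n : nat) (P : 'M[R]_n)
    (sigma : probability (borel_mx R 1 n) R) : Prop :=
  sigma (sphere R n `&` subspace_of P) = 1%E /\
  forall U : 'M[R]_n, orthogonal_mx U ->
    [set x *m U | x in subspace_of P] = subspace_of P ->
    forall A : set (borel_mx R 1 n), measurable A ->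
      sigma [set x | A ((x : 'rV[R]_n) *m U)] = sigma A.

(* sigma_E: the rotation-invariant probability measure on S^{n-1} `&` E. *)
Definition haar_sphere (R : realType) (n : nat) (P : 'M[R]_n) :
    probability (borel_mx R 1 n) R :=
  get [set sigma | is_haar_sphere P sigma].

Definition radon_transform (R : realType) (n : nat) (f : 'rV[R]_n -> R)
    (P : 'M[R]_n) : R :=
  \int[haar_sphere P]_(x in sphere R n `&` subspace_of P) f x.

(* nu = R_m^*(d mu), for non-negative finite Borel measures mu on G(n,m) and
   nu on S^{n-1}. *)
Definition is_dual_radon (R : realType) (n m : nat)
    (mu : {finite_measure set (borel_mx R n n) -> \bar R})
    (nu : {finite_measure set (borel_mx R 1 n) -> \bar R}) : Prop :=
  forall f : 'rV[R]_n -> R, {within sphere R n, continuous f} ->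
    \int[nu]_(x in sphere R n) f x =
    \int[mu]_(P in grassmannian R n m) radon_transform f P.

(* nu is the measure on S^{n-1} with density g with respect to the Haar
   probability measure (1%:M is the projection onto R^n). *)
Definition has_sphere_density (R : realType) (n : nat) (g : 'rV[R]_n -> R)
    (nu : {finite_measure set (borel_mx R 1 n) -> \bar R}) : Prop :=
  forall A : set (borel_mx R 1 n), measurable A ->
    nu A = (\int[haar_sphere (1%:M : 'M[R]_n)]_(x in sphere R n `&` A)
              (g x)%:E)%E.

Definition busemann_petty_bodies (R : realType) (n k : nat) :
    set (set 'rV[R]_n) :=
  [set K | star_body K /\
    exists (mu : {finite_measure set (borel_mx R n n) -> \bar R})
           (nu : {finite_measure set (borel_mx R 1 n) -> \bar R}),
      has_sphere_density (fun x => radial K x ^+ k) nu /\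
      is_dual_radon (n - k) mu nu].
Arguments busemann_petty_bodies : clear implicits.

(* Main.v *)
From HB Require Import structures.
Require Import Defs.
From mathcomp Require Import all_boot all_order all_algebra.
From mathcomp Require Import all_classical all_reals all_analysis.
From mathcomp Require Import measurable_realfun.
From mathcomp Require Import ring lra zify.
Import Order.TTheory GRing.Theory Num.Theory.
Import numFieldNormedType.Exports.

(** For functions of revolution about an axis e everything depends on one
    variable: a function on the sphere on t = <theta, e>^2, and a function
    on the Grassmannian on y = P_ee, the squared length of the projection of
    e onto the subspace.

    Let q(y) = (y - 1/2)^2 - 1/(4 n^2), which is negative near y = 1/2, and
    let mu_q be the signed measure on G(n, n-k) with density q(P_ee) with
    respect to the invariant probability measure. The counterexample K is
    the body with rho_K^k = R_{n-k}^*(mu_q). Evaluated at a direction, a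
    dual Radon transform is an average, here of q over a Beta-distributed
    variable, and this average is a quadratic polynomial in z = 1 - t.
    Because the variable is spread out, the average of q is positive
    although q is not (witness_disc). For the same reason the dual transform
    R_k^* of the image of mu_q under orthogonal complementation is positive;
    up to a constant it is rho_L^(n-k) for a second body L, and K is the
    k-intersection body of L. The spread of the Beta variables is where 2 <=
    k <= n - 2 enters. Smoothness is clear, since both radial functions are
    powers of positive polynomials.

    On the other hand K is not a Busemann-Petty body. If rho_K^k =
    R_{n-k}^*(mu) with mu non-negative, then the integral of rho_K^k h is
    non-negative for each h whose Radon transform R_{n-k} h is non-negative.
    The transform R_{n-k} multiplies the monomials t^j by explicit positive
    constants, turning them into y^j, so there is a polynomial h with
    R_{n-k} h = (y (1 - y))^N. For this h, the integral of rho_K^k h is the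
    mean of (y (1 - y))^N q(y) under the distribution of P_ee, a Beta
    distribution; for N = n^2 it concentrates enough near y = 1/2 to be
    negative (beta_functional_neg).

    Neither mu_q nor L is handled through transforms of measures. What is
    proved directly is a formula for the volumes of central sections
    (section_volume), in which the coefficients for K and L agree
    (section_mean_witness), and a formula for the integral of rho_K^k h
    (test_profile_functional). Both rest on the moments of t on the unit
    sphere of a subspace (haar_moment), which are derived from invariance
    under reflections alone and therefore apply to any invariant measure.

    That an invariant measure exists, and that volumes can be computed from
    it in polar coordinates (polar_volume), follows from the rotation
    invariance of Lebesgue measure on R^m (rv_leb_orth), which in turn comes
    from the uniqueness of translation-invariant measures
    (translation_invariant_unique). *)

Set Implicit Arguments.
Unset Strict Implicit.
Unset Printing Implicit Defensive.

Local Open Scope classical_set_scope.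
Local Open Scope ring_scope.

(** * Borel sets of matrices *)

Lemma open_measurable_mx (R : realType) p q (A : set 'M[R]_(p, q)) :
  open A -> measurable (A : set (borel_mx R p q)).
Proof. by move=> oA; apply: sub_gen_smallest. Qed.

Lemma closed_measurable_mx (R : realType) p q (A : set 'M[R]_(p, q)) :
  closed A -> measurable (A : set (borel_mx R p q)).
Proof.
move=> cA; rewrite -(setCK A); apply: measurableC; apply: open_measurable_mx.
exact: closed_openC.
Qed.

Lemma continuous_measurable_mx (R : realType) p q p' q'
    (f : 'M[R]_(p, q) -> 'M[R]_(p', q')) :
  continuous f -> measurable_fun setT (f : borel_mx R p q -> borel_mx R p' q').
Proof.
move=> /continuousP cf.
apply: (@measurability _ _ _ (borel_mx R p' q') _ _ (@open 'M[R]_(p', q')))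
  => // _ [A oA <-].
by rewrite setTI; apply: open_measurable_mx; exact: cf.
Qed.

Lemma continuous_measurable_mx_real (R : realType) p q (f : 'M[R]_(p, q) -> R) :
  continuous f -> measurable_fun setT (f : borel_mx R p q -> R).
Proof.
move=> /continuousP cf.
apply: (measurability _ (measurable_realfun.RGenOpens.measurableE R)).
move=> _ [_ [a [b ->]] <-]; rewrite setTI.
by apply: open_measurable_mx; apply: cf; exact: interval_open.
Qed.

Lemma ball_mxP (R : realType) p q (c : 'M[R]_(p, q)) (r : R) (x : 'M[R]_(p, q))
  :
  0 < r -> ball c r x <-> forall i j, `|c i j - x i j| < r.
Proof.
move=> r0; split.
  by move=> [_ H] i j; exact: H.
by move=> H; split => // i j; exact: H.
Qed.

(** An open set is the union of the countably many rational boxes that it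
    contains, and the preimage of a box is a finite intersection of preimages
    under the entries. *)
Lemma measurable_fun_mx (R : realType) d (T : measurableType d) p q
    (f : T -> 'M[R]_(p, q)) :
  (forall i j, measurable_fun setT (fun t => f t i j)) ->
  measurable_fun setT (f : T -> borel_mx R p q).
Proof.
move=> mf; apply: (@measurability _ _ _ (borel_mx R p q) _ _
  (@open 'M[R]_(p, q))) => // _ [A oA <-].
rewrite setTI.
pose B (u : 'M[rat]_(p, q) * rat) : set 'M[R]_(p, q) :=
  [set x | forall i j, `|ratr (u.1 i j) - x i j| < ratr u.2].
have -> : f @^-1` A = \bigcup_(u : 'M[rat]_(p, q) * rat)
     (if `[< B u `<=` A >] then f @^-1` B u else set0).
  apply/seteqP; split => t /=.
    move=> Aft; have /nbhs_ballP[e /= e0 eA] : nbhs (f t) A.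
      exact: open_nbhs_nbhs.
    have e20 : 0 < e / 2 by lra.
    have [r] := rat_in_itvoo e20; rewrite in_itv/= => /andP[r0 re].
    have HC i j : exists c : rat, `|ratr c - f t i j| < ratr r.
      have : f t i j - ratr r < f t i j + ratr r by lra.
      by move=> /rat_in_itvoo[c]; rewrite in_itv/= => /andP[c1 c2]; exists c;
        rewrite ltr_norml; apply/andP; split; lra.
    have [c Hc] := choice (fun u : 'I_p * 'I_q => HC u.1 u.2).
    exists (\matrix_(i, j) c (i, j), r) => //.
    case: asboolP => [_|[]].
      by move=> i j /=; rewrite mxE; exact: Hc (i, j).
    move=> x /= Bx; apply: eA; apply/ball_mxP => // i j.
    have := Bx i j; have := Hc (i, j); rewrite /= mxE => h1 h2.
    rewrite (_ : _ - _ = (f t i j - ratr (c (i,j))) +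
      (ratr (c (i, j)) - x i j));
       last by ring.
    rewrite (le_lt_trans (ler_normD _ _))// distrC; lra.
  by move=> [u _]; case: asboolP => // + ?; exact.
apply: countable_bigcupT_measurable => // u; case: asboolP => // _.
have -> : f @^-1` B u = \bigcap_(ij : 'I_p * 'I_q)
    ((fun t => f t ij.1 ij.2) @^-1` `]ratr (u.1 ij.1 ij.2) - ratr u.2,
                         ratr (u.1 ij.1 ij.2) + ratr u.2[).
  apply/seteqP; split => t /=.
    move=> H [i j] _ /=; rewrite in_itv/=; have := H i j.
    by rewrite ltr_norml => /andP[? ?]; apply/andP; split; lra.
  move=> H i j; have := H (i, j) I; rewrite /= in_itv/= => /andP[? ?].
  by rewrite ltr_norml; apply/andP; split; lra.
apply: fin_bigcap_measurable => [|[i j] _]; first exact: finite_finset.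
by rewrite -[X in measurable X]setTI; apply: mf.
Qed.

Lemma measurable_coord (R : realType) p q i j :
  measurable_fun setT (fun x : borel_mx R p q => (x : 'M[R]_(p, q)) i j).
Proof. by apply: continuous_measurable_mx_real; exact: coord_continuous. Qed.

Lemma continuous_addr_mx (R : realType) p q (v : 'M[R]_(p, q)) :
  continuous (fun x : 'M[R]_(p, q) => x + v).
Proof.
by move=> x; apply: (@continuousD _ _ _ id (cst v));
  [exact: cvg_id|exact: cst_continuous].
Qed.

Lemma continuous_oppr_mx (R : realType) p q :
  continuous (fun x : 'M[R]_(p, q) => - x).
Proof. by move=> x; apply: (@continuousN _ _ _ id); exact: cvg_id. Qed.

(** * The Euclidean inner product *)

Section dot.
Variable R : realType.

Definition dot n (x y : 'rV[R]_n) : R := (x *m y^T) 0 0.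

Lemma dotE n (x y : 'rV[R]_n) : dot x y = \sum_j x 0 j * y 0 j.
Proof. by rewrite /dot mxE; apply: eq_bigr => j _; rewrite mxE. Qed.

Lemma dotC n (x y : 'rV[R]_n) : dot x y = dot y x.
Proof. by rewrite !dotE; apply: eq_bigr => j _; rewrite mulrC. Qed.

Lemma dotDl n (x y z : 'rV[R]_n) : dot (x + y) z = dot x z + dot y z.
Proof. by rewrite /dot mulmxDl mxE. Qed.

Lemma dotZl n a (x z : 'rV[R]_n) : dot (a *: x) z = a * dot x z.
Proof. by rewrite /dot -scalemxAl mxE. Qed.

Lemma dotDr n (x y z : 'rV[R]_n) : dot z (x + y) = dot z x + dot z y.
Proof. by rewrite dotC dotDl !(dotC z). Qed.

Lemma dotZr n a (x z : 'rV[R]_n) : dot z (a *: x) = a * dot z x.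
Proof. by rewrite dotC dotZl dotC. Qed.

Lemma dot0l n (z : 'rV[R]_n) : dot 0 z = 0.
Proof. by rewrite /dot mul0mx mxE. Qed.

Lemma dotNl n (x z : 'rV[R]_n) : dot (- x) z = - dot x z.
Proof. by rewrite -scaleN1r dotZl mulN1r. Qed.

Lemma dotNr n (x z : 'rV[R]_n) : dot z (- x) = - dot z x.
Proof. by rewrite dotC dotNl dotC. Qed.

Lemma dot_mulmx n m (x : 'rV[R]_n) (M : 'M[R]_(n, m)) (y : 'rV[R]_m) :
  dot (x *m M) y = dot x (y *m M^T).
Proof. by rewrite /dot trmx_mul trmxK mulmxA. Qed.

Lemma dot_ge0 n (x : 'rV[R]_n) : 0 <= dot x x.
Proof. by rewrite dotE; apply: sumr_ge0 => j _; rewrite -expr2 sqr_ge0. Qed.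

Lemma dot_eq0 n (x : 'rV[R]_n) : dot x x = 0 -> x = 0.
Proof.
rewrite dotE => /eqP; rewrite psumr_eq0 => [/allP H|j _]; last first.
  by rewrite -expr2 sqr_ge0.
apply/rowP => j; rewrite mxE; have := H j (mem_index_enum j).
by rewrite /= -expr2 sqrf_eq0 => /eqP.
Qed.

Lemma dot_gt0 n (x : 'rV[R]_n) : x != 0 -> 0 < dot x x.
Proof.
by move=> x0; rewrite lt_neqAle dot_ge0 andbT eq_sym; apply: contra_neq x0 =>
  /dot_eq0.
Qed.

Lemma sqr_coord_le_dot n (x : 'rV[R]_n) j : x 0 j ^+ 2 <= dot x x.
Proof.
rewrite dotE (bigD1 j)//= -expr2 lerDl sumr_ge0// => i _.
by rewrite -expr2 sqr_ge0.
Qed.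

Lemma mx11E (M : 'M[R]_1) : (M = 1%:M) <-> M 0 0 = 1.
Proof.
split => [->|M1]; first by rewrite mxE.
by apply/matrixP => i j; rewrite !ord1 M1 mxE.
Qed.

Lemma sphereE n (x : 'rV[R]_n) : sphere R n x <-> dot x x = 1.
Proof. exact: mx11E. Qed.

Lemma dot_delta n (x : 'rV[R]_n) j : dot x (delta_mx 0 j) = x 0 j.
Proof.
rewrite dotE (bigD1 j)//= mxE !eqxx mulr1 big1 ?addr0// => i ij.
by rewrite mxE (negbTE ij) andbF mulr0.
Qed.

Lemma continuous_sum (T : topologicalType) (V : normedModType R) (I : Type)
    (r : seq I) (F : I -> T -> V) :
  (forall i, continuous (F i)) -> continuous (fun x => \sum_(i <- r) F i x).
Proof.
move=> cF x; elim: r => [|i r IH].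
  by under eq_fun do rewrite big_nil; exact: cvg_cst.
under eq_fun do rewrite big_cons.
by apply: cvgD IH; exact: cF.
Qed.

Lemma continuous_dot n (x : 'rV[R]_n) : continuous (fun y => dot y x).
Proof.
under eq_fun do rewrite dotE.
apply: continuous_sum => j y.
by apply: continuousM; [exact: coord_continuous|exact: cst_continuous].
Qed.

Lemma continuous_sqn n : continuous (fun y : 'rV[R]_n => dot y y).
Proof.
under eq_fun do rewrite dotE.
by apply: continuous_sum => j y; apply: continuousM; exact: coord_continuous.
Qed.

Lemma continuous_mulmx n m (M : 'M[R]_(n, m)) :
  continuous (fun x : 'rV[R]_n => x *m M).
Proof.
have -> : (fun x : 'rV[R]_n => x *m M) =
   (fun x => \sum_i x 0 i *: row i M).
  by apply/funext => x; rewrite mulmx_sum_row.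
apply: continuous_sum => i x.
by apply: continuousZr_tmp; exact: coord_continuous.
Qed.

Lemma continuous_add_fun (T : topologicalType) (f g : T -> R) :
  continuous f -> continuous g -> continuous (fun x => f x + g x).
Proof. by move=> cf cg x; apply: continuousD; [exact: cf|exact: cg]. Qed.

Lemma continuous_sub_fun (T : topologicalType) (f g : T -> R) :
  continuous f -> continuous g -> continuous (fun x => f x - g x).
Proof. by move=> cf cg x; apply: continuousB; [exact: cf|exact: cg]. Qed.

Lemma continuous_mul_fun (T : topologicalType) (f g : T -> R) :
  continuous f -> continuous g -> continuous (fun x => f x * g x).
Proof. by move=> cf cg x; apply: continuousM; [exact: cf|exact: cg]. Qed.

Lemma continuous_exp_fun (T : topologicalType) (f : T -> R) j :
  continuous f -> continuous (fun x => f x ^+ j).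
Proof.
move=> cf x; apply: (@continuous_comp _ _ _ f (fun t => t ^+ j)).
  exact: cf.
exact: exprn_continuous.
Qed.

Lemma closed_le_continuous (T : topologicalType) (f g : T -> R) :
  continuous f -> continuous g -> closed [set x | f x <= g x].
Proof.
move=> cf cg; rewrite (_ : mkset _ = (g \- f) @^-1` [set r | 0 <= r]).
  apply: closed_comp; last exact: closed_ge.
  by move=> x _; apply: continuousB; [exact: cg|exact: cf].
by apply/seteqP; split => x /=; rewrite subr_ge0.
Qed.

Lemma closed_set0_rV n : closed [set (0 : 'rV[R]_n)].
Proof.
rewrite (_ : [set 0] = [set x | dot x x <= 0]).
  by apply: closed_le_continuous; [exact: continuous_sqn|exact: cst_continuous].
apply/seteqP; split => x /=; first by move=> ->; rewrite dot0l.
by move=> x0; apply: dot_eq0; apply/eqP; rewrite eq_le x0 dot_ge0.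
Qed.

Lemma closed_sphere n : closed (sphere R n).
Proof.
rewrite (_ : sphere R n = [set x | dot x x <= 1] `&` [set x | 1 <= dot x x]).
  by apply: closedI; apply: closed_le_continuous;
    do ?[exact: continuous_sqn|exact: cst_continuous].
apply/seteqP; split => x /=; first by move=> /sphereE ->; rewrite lexx.
by move=> [h1 h2]; apply/sphereE/eqP; rewrite eq_le h1.
Qed.

End dot.

(** * Lebesgue measure on row vectors *)

Section image_measure.
Context d1 d2 (X : measurableType d1) (Y : measurableType d2) (R : realType).
Variable phi : X -> Y.

(** The measurability proof is an argument so that the measure structure on
    the pushforward can be inferred. *)
Definition image_measure of measurable_fun setT phi :=
  fun mu : {measure set X -> \bar R} => pushforward mu phi.

Variables (mphi : measurable_fun setT phi) (mu : {measure set X -> \bar R}).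
Local Open Scope ereal_scope.

Let image_measure0 : image_measure mphi mu set0 = 0.
Proof. by rewrite /image_measure /pushforward preimage_set0 measure0. Qed.

Let image_measure_ge0 A : 0 <= image_measure mphi mu A.
Proof. exact: measure_ge0. Qed.

Let image_measure_sigma_additive : semi_sigma_additive (image_measure mphi mu).
Proof. exact: measure_semi_sigma_additive. Qed.

HB.instance Definition _ := isMeasure.Build _ _ _ (image_measure mphi mu)
  image_measure0 image_measure_ge0 image_measure_sigma_additive.

End image_measure.

Section sigma_finite_measure_of.
Context d (T : measurableType d) (R : realType).

(** The proof of sigma-finiteness is an argument so that the structure can be
    inferred. *)
Definition sigma_finite_measure_of (mu : {measure set T -> \bar R})
  of sigma_finite setT mu : set T -> \bar R := mu.

Variables (mu : {measure set T -> \bar R}) (h : sigma_finite setT mu).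
HB.instance Definition _ := Measure.copy (sigma_finite_measure_of h) mu.
HB.instance Definition _ :=
  Measure_isSigmaFinite.Build _ _ _ (sigma_finite_measure_of h) h.

End sigma_finite_measure_of.

Section lebesgue_rv.
Variable R : realType.
Local Notation leb := (@lebesgue_measure R).

Definition box m (a b : R) : set 'rV[R]_m := [set x | forall j, a < x 0 j <= b].
Arguments box : clear implicits.

(** The coordinates in which the iterated volume of a set is a double
    integral. *)
Definition cons_rv m (p : R * 'rV[R]_m) : 'rV[R]_m.+1 :=
  row_mx (p.1%:M : 'M[R]_1) p.2.

Lemma cons_rvE m p j :
  @cons_rv m p 0 j = if unlift ord0 j is Some j' then p.2 0 j' else p.1.
Proof.
rewrite /cons_rv mxE; case: splitP => [i|i] ji.
  by rewrite (ord1 i) mxE eqxx mulr1n; case: unliftP => // j' jj'; move: ji;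
    rewrite jj' ord1.
by case: unliftP ji => [j' ->|->] //= [ji]; congr (_ _ _); apply: val_inj.
Qed.

Lemma cons_rv0 m p : @cons_rv m p 0 ord0 = p.1.
Proof. by rewrite cons_rvE unlift_none. Qed.

Lemma cons_rvS m p j : @cons_rv m p 0 (lift ord0 j) = p.2 0 j.
Proof. by rewrite cons_rvE liftK. Qed.

Lemma measurable_cons_rv m :
  measurable_fun setT (@cons_rv m : measurableTypeR R * borel_mx R 1 m ->
    borel_mx R 1 m.+1).
Proof.
apply: measurable_fun_mx => i j; rewrite (ord1 i).
have [j' ->|->] := unliftP ord0 j.
  under eq_fun do rewrite cons_rvS.
  exact: (measurableT_comp (measurable_coord 0 j') (@measurable_snd _ _ _ _)).
under eq_fun do rewrite cons_rv0.
exact: measurable_fst.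
Qed.

Lemma cons_rv_box m a b :
  (@cons_rv m) @^-1` (box m.+1 a b) = `]a, b]%classic `*` box m a b.
Proof.
apply/seteqP; split => -[t y] /=.
  move=> H; split; first by have := H ord0; rewrite cons_rv0 /= in_itv.
  by move=> j; have := H (lift ord0 j); rewrite cons_rvS.
move=> [+ H] j; rewrite /= in_itv /= => ht.
by have [j' ->|->] := unliftP ord0 j; rewrite ?cons_rvS ?cons_rv0.
Qed.

Lemma measurable_box m a b : measurable (box m a b : set (borel_mx R 1 m)).
Proof.
have -> : box m a b =
    \bigcap_(j : 'I_m) ((fun x : borel_mx R 1 m => (x : 'rV[R]_m) 0 j) @^-1`
      `]a, b]).
  apply/seteqP; split => x /= H j => [_|]; first by rewrite /= in_itv; exact: H.
  by have := H j I; rewrite /= in_itv.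
apply: fin_bigcap_measurable => [|j _]; first exact: finite_finset.
by rewrite -[X in measurable X]setTI; apply: measurable_coord.
Qed.

Lemma box_cover m : \bigcup_i (box m (- i%:R) i%:R) = setT.
Proof.
apply/seteqP; split => // x _.
have [N hN] : exists N : nat, forall j, `|x 0 j| < N%:R.
  exists (\max_(j < m) (Num.truncn `|x 0%R j|%R).+1)%N => j.
  apply: (lt_le_trans (truncnS_gt _)); rewrite ler_nat.
  exact: (leq_bigmax (F := fun j => (Num.truncn `|x 0%R j|%R).+1)).
exists N => // j; have := hN j; rewrite ltr_norml => /andP[h1 h2].
by rewrite h1 ltW.
Qed.

Lemma sigma_finite_box m (L : {measure set (borel_mx R 1 m) -> \bar R}) :
  (forall a b, a <= b -> L (box m a b) = ((b - a) ^+ m)%:E) ->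
  sigma_finite setT L.
Proof.
move=> HL; exists (fun i : nat => box m (- i%:R) i%:R).
  by rewrite box_cover.
move=> i; split; first exact: measurable_box.
by rewrite HL ?ltry// lerNl (le_trans _ (ler0n _ i))// oppr_le0 ler0n.
Qed.

(** The iterated volume is defined on all sets, but it is countably additive
    only on the Borel ones. Its recursive clause is the integral of the
    measures of sections that defines a product measure, so the measure in
    dimension m + 1 is the image under cons_rv of a product; the value on
    boxes is carried through the induction because it gives
    sigma-finiteness. *)
Lemma volume_measure_exists m :
  exists L : {sigma_finite_measure set (borel_mx R 1 m) -> \bar R},
    (forall A, measurable A -> L A = volume A) /\
    (forall a b, a <= b -> L (box m a b) = ((b - a) ^+ m)%:E).
Proof.
elim: m => [|m [L [LE Lbox]]].
  pose D := (@dirac _ (borel_mx R 1 0) 0 R).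
  have Dbox a b : a <= b -> D (box 0 a b) = ((b - a) ^+ 0)%:E.
    by move=> _; rewrite /D diracE mem_set// => -[].
  by exists (sigma_finite_measure_of (sigma_finite_box Dbox));
    split => // A mA /=.
pose D := image_measure (@measurable_cons_rv m) (leb \x L)%E.
have Dbox a b : a <= b -> D (box m.+1 a b) = ((b - a) ^+ m.+1)%:E.
  move=> ab; rewrite /D /image_measure /pushforward cons_rv_box.
  transitivity (leb `]a, b]%classic * L (box m a b))%E.
    by apply: product_measure1E => //; exact: measurable_box.
  rewrite Lbox// exprS EFinM lebesgue_measure_itv/= lte_fin.
  by move: ab; rewrite le_eqVlt => /predU1P[->|->]; rewrite ?ltxx ?subrr ?EFinB.
exists (sigma_finite_measure_of (sigma_finite_box Dbox)); split => // A mA /=.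
rewrite /D /image_measure /pushforward /= /product_measure1.
apply: eq_integral => t _ /=; rewrite LE; last first.
  apply: measurable_xsection.
  by rewrite -[X in measurable X]setTI; apply: measurable_cons_rv.
by congr volume; apply/seteqP; split => y /=; rewrite /xsection /= inE.
Qed.

Definition rv_leb m : {sigma_finite_measure set (borel_mx R 1 m) -> \bar R} :=
  projT1 (cid (volume_measure_exists m)).

Lemma rv_lebE m A : measurable A -> rv_leb m A = volume A.
Proof. exact: (projT2 (cid (volume_measure_exists m))).1. Qed.

Lemma rv_leb_box m a b : a <= b -> rv_leb m (box m a b) = ((b - a) ^+ m)%:E.
Proof. exact: (projT2 (cid (volume_measure_exists m))).2. Qed.

End lebesgue_rv.
Arguments box {R} m a b.
Arguments rv_leb {R} m.

(** * Invariance of Lebesgue measure *)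

Section rv_leb_invariance.
Variable R : realType.
Local Notation leb := (@lebesgue_measure R).

Lemma lebesgue_translate (a : R) (A : set (measurableTypeR R)) : measurable A ->
  leb ((fun x => x + a) @^-1` A) = leb A.
Proof.
have ma : measurable_fun setT (fun x : measurableTypeR R => x + a :
  measurableTypeR R).
  exact: measurable_funD.
move=> mA; transitivity (image_measure ma leb A) => //; apply/esym.
apply: lebesgue_measure_unique => //= _ [[u v] _ <-] /=.
rewrite /image_measure /pushforward.
have -> : (fun x => x + a) @^-1` `]u, v]%classic = `]u - a, v - a]%classic.
  by apply/seteqP; split => x /=; rewrite !in_itv/= ltrBlDr lerBrDr.
rewrite !lebesgue_measure_itv/= !lte_fin ltrD2r -!EFinB.
by case: ifP => // _; congr EFin; ring.
Qed.

Lemma integral_translate (a : R) (f : measurableTypeR R -> \bar R) :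
  measurable_fun setT f -> (forall x, 0 <= f x)%E ->
  (\int[leb]_x f (x + a)%R = \int[leb]_x f x)%E.
Proof.
move=> mf f0.
have ma : measurable_fun setT (fun x : measurableTypeR R => x + a :
  measurableTypeR R).
  exact: measurable_funD.
rewrite -[LHS](@ge0_integral_pushforward _ _ _ _ _ _ ma leb setT f)//.
by apply: (eq_measure_integral leb) => A mA _; exact: lebesgue_translate.
Qed.

Lemma rv_leb_cons m (A : set (borel_mx R 1 m.+1)) : measurable A ->
  rv_leb m.+1 A = (\int[leb]_t rv_leb m [set y | A (cons_rv (t, y))])%E.
Proof.
move=> mA; rewrite rv_lebE//=; apply: eq_integral => t _; rewrite rv_lebE//.
rewrite (_ : [set y | _] = xsection (@cons_rv R m @^-1` A) t); last first.
  by apply/seteqP; split => y /=; rewrite /xsection /= inE.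
apply: measurable_xsection.
by rewrite -[X in measurable X]setTI; apply: measurable_cons_rv.
Qed.

Lemma measurable_rv_leb_cons m (A : set (borel_mx R 1 m.+1)) : measurable A ->
  measurable_fun setT (fun t => rv_leb m [set y | A (cons_rv (t, y))]).
Proof.
move=> mA; rewrite (_ : (fun t => _) =
    rv_leb m \o xsection (@cons_rv R m @^-1` A)); last first.
  apply/funext => t /=; congr (rv_leb m _).
  by apply/seteqP; split => y /=; rewrite /xsection /= inE.
apply: (@measurable_fun_xsection _ _ (measurableTypeR R)).
by rewrite -[X in measurable X]setTI; apply: measurable_cons_rv.
Qed.

(** Translating the first coordinate reduces to the one-dimensional case, and
    the other coordinates are handled section by section by induction. *)
Lemma rv_leb_translate m (v : 'rV[R]_m) (A : set (borel_mx R 1 m)) :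
  measurable A -> rv_leb m [set x | A (x + v)] = rv_leb m A.
Proof.
elim: m v A => [|m IH] v A mA.
  congr (rv_leb 0 _); apply/seteqP; split => x /=; by rewrite (thinmx0 v) addr0.
have mT : measurable [set x : borel_mx R 1 m.+1 | A ((x : 'rV_m.+1) + v)].
  rewrite -[X in measurable X]setTI.
  exact: (continuous_measurable_mx (@continuous_addr_mx _ _ _ v) measurableT
    mA).
rewrite !rv_leb_cons//.
pose v0 := v 0 ord0; pose v' : 'rV[R]_m := \row_j v 0 (lift ord0 j).
have E t y : cons_rv (t, y) + v = cons_rv (t + v0, y + v').
  apply/rowP => j; rewrite mxE; have [j' ->|->] := unliftP ord0 j.
    by rewrite !cons_rvS !mxE.
  by rewrite !cons_rv0.
transitivity (\int[leb]_t rv_leb m [set y | A (cons_rv (t + v0, y)%R)])%E.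
  apply: eq_integral => t _; rewrite -[RHS](IH v').
    by congr (rv_leb m _); apply/seteqP; split => y /=; rewrite E.
  rewrite (_ : [set y | _] = xsection (@cons_rv R m @^-1` A) (t + v0)).
    apply: measurable_xsection.
    by rewrite -[X in measurable X]setTI; apply: measurable_cons_rv.
  by apply/seteqP; split => y /=; rewrite /xsection /= inE.
rewrite (@integral_translate v0
  (fun t => rv_leb m [set y | A (cons_rv (t, y))]))//.
exact: measurable_rv_leb_cons.
Qed.

(** The usual proof that Haar measure is unique: by Tonelli and invariance,
    the product of nu A and rv_leb B is the integral over x and y of 1_A(x)
    1_B(x + y), and replacing x by x - y turns it into the integral of 1_A(x -
    y) 1_B(x), which is the other product. *)
Lemma translation_invariant_swap m
    (nu : {sigma_finite_measure set (borel_mx R 1 m) -> \bar R}) :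
  (forall v (A : set (borel_mx R 1 m)), measurable A ->
     nu [set x : borel_mx R 1 m | A ((x : 'rV_m) + v)] = nu A) ->
  forall A B : set (borel_mx R 1 m), measurable A -> measurable B ->
  (nu A * rv_leb m B = rv_leb m [set x | A (- (x : 'rV[R]_m))%R] * nu B)%E.
Proof.
move=> nuT A B mA mB.
have m1 : measurable_fun setT (fst : borel_mx R 1 m * borel_mx R 1 m -> _).
  exact: measurable_fst.
have madd : measurable_fun setT
    (fun p : borel_mx R 1 m * borel_mx R 1 m =>
       ((p.1 : 'rV[R]_m) + p.2 : borel_mx R 1 m)).
  apply: measurable_fun_mx => i j; under eq_fun do rewrite mxE.
  apply: measurable_funD.
    exact: (measurableT_comp (measurable_coord i j) (@measurable_fst _ _ _ _)).
  exact: (measurableT_comp (measurable_coord i j) (@measurable_snd _ _ _ _)).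
have mN : measurable [set x : borel_mx R 1 m | A (- (x : 'rV[R]_m))%R].
  rewrite -[X in measurable X]setTI.
  exact: (continuous_measurable_mx (@continuous_oppr_mx R 1 m) measurableT mA).
(* S is integrated over y first for xE, and over x first for yE. *)
pose S := [set p : borel_mx R 1 m * borel_mx R 1 m |
    A p.1 /\ B ((p.1 : 'rV_m) + p.2)].
have mS : measurable S.
  apply: (@measurableI _ _ (fst @^-1` A)).
    by rewrite -[X in measurable X]setTI; apply: m1.
  by rewrite -[X in measurable X]setTI; apply: madd.
have xE : (\int[nu]_x rv_leb m (xsection S x) = nu A * rv_leb m B)%E.
  rewrite (eq_integral (fun x => (\1_A x)%:E * rv_leb m B)%E); last first.
    move=> x _; rewrite indicE; have [xA|xA] := boolP (x \in A).
      rewrite mul1e -[RHS](rv_leb_translate x mB); congr (rv_leb m _).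
      apply/seteqP; split => y; rewrite /xsection /= inE /S/=.
        by move=> [_]; rewrite addrC.
      by rewrite addrC; split => //; exact: set_mem.
    rewrite mul0e (_ : xsection _ _ = set0) ?measure0//.
    apply/seteqP; split => y //; rewrite /xsection /= inE /S/= => -[xA' _].
    by move: xA; rewrite mem_set.
  by rewrite ge0_integralZr ?integral_indic ?setIT//; exact: measurableT_comp.
have yE : (\int[rv_leb m]_y nu (ysection S y) =
    rv_leb m [set x | A (- (x : 'rV[R]_m))%R] * nu B)%E.
  rewrite (eq_integral (fun y : borel_mx R 1 m => nu
     (ysection [set p : borel_mx R 1 m * borel_mx R 1 m |
        A ((p.1 : 'rV[R]_m) - p.2)%R /\ B p.1] y)))%E; last first.
    move=> y _; rewrite -[RHS](nuT y); last first.
      rewrite (_ : ysection _ _ = [set x | A ((x : 'rV_m) - y)] `&` B).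
        apply: measurableI => //.
        rewrite -[X in measurable X]setTI.
        exact: (continuous_measurable_mx
          (@continuous_addr_mx _ _ _ (- (y : 'rV_m))) measurableT mA).
      by apply/seteqP; split => x; rewrite /ysection /= inE.
    congr (nu _); apply/seteqP; split => x; rewrite /ysection /= !inE /=;
      by rewrite addrK.
  have mS' : measurable [set p : borel_mx R 1 m * borel_mx R 1 m |
        A ((p.1 : 'rV[R]_m) - p.2)%R /\ B p.1].
    have msub : measurable_fun setT
      (fun p : borel_mx R 1 m * borel_mx R 1 m =>
        ((p.1 : 'rV[R]_m) - p.2 : borel_mx R 1 m)).
      apply: measurable_fun_mx => i j; under eq_fun do rewrite !mxE.
      apply: measurable_funB.
       exact: (measurableT_comp (measurable_coord i j)
         (@measurable_fst _ _ _ _)).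
      exact: (measurableT_comp (measurable_coord i j)
        (@measurable_snd _ _ _ _)).
    apply: measurableI.
      by rewrite -[X in measurable X]setTI; apply: msub.
    by rewrite -[X in measurable X]setTI; apply: m1.
  have := indic_fubini_tonelli nu (rv_leb m) mS'.
  rewrite indic_fubini_tonelli_FE// indic_fubini_tonelli_GE// => <-.
  rewrite (eq_integral (fun x => rv_leb m [set x | A (- (x : 'rV[R]_m))%R] *
     (\1_B x)%:E)%E); last first.
    move=> x _ /=; rewrite indicE; have [xB|xB] := boolP (x \in B).
      rewrite mule1 -[RHS](rv_leb_translate (- x) mN); congr (rv_leb m _).
      apply/seteqP; split => y; rewrite /xsection /= inE /= opprB.
        by case.
      by split => //; exact: set_mem.
    rewrite mule0 (_ : xsection _ _ = set0) ?measure0//.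
    apply/seteqP; split => y //; rewrite /xsection /= inE /= => -[_ xB'].
    by move: xB; rewrite mem_set.
  by rewrite ge0_integralZl ?integral_indic ?setIT//; exact: measurableT_comp.
rewrite -xE -yE.
have := indic_fubini_tonelli nu (rv_leb m) mS.
by rewrite indic_fubini_tonelli_FE// indic_fubini_tonelli_GE.
Qed.

(** Two uses of translation_invariant_swap with the unit box, for nu and for
    Lebesgue measure itself; the latter shows that x |-> - x preserves
    volume. *)
Lemma translation_invariant_unique m
    (nu : {sigma_finite_measure set (borel_mx R 1 m) -> \bar R}) :
  (forall v (A : set (borel_mx R 1 m)), measurable A ->
     nu [set x : borel_mx R 1 m | A ((x : 'rV_m) + v)] = nu A) ->
  forall A : set (borel_mx R 1 m), measurable A ->
    (nu A = nu (box m 0 1) * rv_leb m A)%E.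
Proof.
move=> nuT A mA.
have b1 : rv_leb m (@box R m 0 1) = 1%E by rewrite rv_leb_box// subr0 expr1n.
have := @translation_invariant_swap m (rv_leb m) (@rv_leb_translate m) A
  (@box R m 0 1) mA
  (@measurable_box R m 0 1).
rewrite b1 !mule1 => ->.
have := @translation_invariant_swap m nu nuT A (@box R m 0 1) mA
  (@measurable_box R m 0 1).
by rewrite b1 mule1 muleC => ->.
Qed.

Lemma measurable_mulmx m p (M : 'M[R]_(m, p)) (A : set (borel_mx R 1 p)) :
  measurable A -> measurable [set x :
    borel_mx R 1 m | A ((x : 'rV[R]_m) *m M)%R].
Proof.
move=> mA; rewrite -[X in measurable X]setTI.
exact: (continuous_measurable_mx (@continuous_mulmx R m p M) measurableT mA).
Qed.

(** The image of Lebesgue measure under an invertible linear map is again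
    invariant under translations, hence a multiple of Lebesgue measure; the
    factor can be computed from any one set of positive finite volume. *)
Lemma rv_leb_linear m (M : 'M[R]_m) : M \in unitmx ->
  forall A : set (borel_mx R 1 m), measurable A ->
  (rv_leb m [set x | A ((x : 'rV[R]_m) *m M)%R] =
   rv_leb m [set x | @box R m 0 1 ((x : 'rV[R]_m) *m M)%R] * rv_leb m A)%E.
Proof.
move=> uM A mA.
have mM := continuous_measurable_mx (@continuous_mulmx R m m M).
pose nu0 := image_measure mM (rv_leb m).
have s : sigma_finite setT nu0.
  exists (fun i : nat => [set x | box m (- i%:R) i%:R
    ((x : 'rV_m) *m invmx M)]).
    apply/seteqP; split => // x _.
    have : (\bigcup_i (box m (- i%:R) i%:R)) (x *m invmx M) by rewrite
      box_cover.
    by move=> [i _ h]; exists i.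
  move=> i; split.
    by apply: (@measurable_mulmx m m (invmx M)); exact: measurable_box.
  rewrite /nu0 /image_measure /pushforward /=.
  rewrite (_ : _ @^-1` _ = box m (- i%:R) i%:R); last first.
    by apply/seteqP; split => x /=; rewrite mulmxK.
  by rewrite rv_leb_box ?ltry// lerNl (le_trans _ (ler0n _ i))// oppr_le0 ler0n.
apply: (translation_invariant_unique (nu := sigma_finite_measure_of s)) => //.
move=> v B mB.
rewrite /sigma_finite_measure_of /nu0 /image_measure /pushforward /=.
rewrite -[RHS](rv_leb_translate (v *m invmx M)); last exact: measurable_mulmx.
by congr (rv_leb m _); apply/seteqP; split => x /=; rewrite mulmxDl mulmxKV.
Qed.

(** The factor in rv_leb_linear is the volume of a rescaled unit box. *)
Lemma rv_leb_scale m (r : R) (A : set (borel_mx R 1 m)) : 0 < r ->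
  measurable A ->
  rv_leb m [set x | A (r *: (x : 'rV[R]_m))%R] = ((r ^- m)%:E * rv_leb m A)%E.
Proof.
move=> r0 mA.
have rE (x : 'rV[R]_m) : r *: x = x *m r%:M by rewrite mul_mx_scalar.
have ur : (r%:M : 'M[R]_m) \in unitmx.
  by rewrite unitmxE det_scalar unitfE expf_neq0// gt_eqF.
under eq_set do rewrite rE.
rewrite rv_leb_linear//; congr (_ * _)%E.
rewrite (_ : [set x | _] = box m 0 r^-1); last first.
  apply/seteqP; split => x /= H j; have := H j; rewrite mul_mx_scalar mxE.
    by rewrite pmulr_rgt0// -ler_pdivlMl// mulr1.
  by rewrite pmulr_rgt0// -ler_pdivlMl// mulr1.
by rewrite rv_leb_box ?subr0 ?exprVn// invr_ge0 ltW.
Qed.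

Lemma rv_leb_set0 m : (0 < m)%N -> rv_leb m [set (0 : 'rV[R]_m)] = 0%E.
Proof.
move=> m0; apply/eqP; rewrite eq_le measure_ge0 andbT.
apply/lee_addgt0Pr => e e0; rewrite add0e.
have m0' : measurable ([set 0] : set (borel_mx R 1 m)).
  by apply: closed_measurable_mx; exact: closed_set0_rV.
(* The origin lies in the box ]-d, 0]^m, of volume d^m <= d <= e. *)
pose d := Num.min 1 e.
have d0 : 0 < d by rewrite lt_min ltr01.
rewrite (@le_trans _ _ (rv_leb m (box m (- d) 0)))//.
  apply: le_measure; rewrite ?inE//; first exact: measurable_box.
  by move=> x /= -> j; rewrite mxE oppr_lt0 d0 lexx.
rewrite rv_leb_box; last by rewrite oppr_le0 ltW.
rewrite sub0r opprK lee_fin.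
case: m m0 m0' => // m _ _; rewrite exprS.
rewrite (@le_trans _ _ d)//; last by rewrite ge_min lexx orbT.
by rewrite ler_piMr ?(ltW d0)// exprn_ile1 ?(ltW d0)// ge_min lexx.
Qed.

(** The origin is left out because it has no direction. *)
Definition punctured_ball m : set 'rV[R]_m :=
  [set x | x != 0 /\ dot x x <= 1].
Arguments punctured_ball : clear implicits.

Lemma measurable_punctured_ball m :
  measurable (punctured_ball m : set (borel_mx R 1 m)).
Proof.
rewrite (_ : punctured_ball m = ~` [set 0] `&` [set x | dot x x <= 1]).
  apply: measurableI.
    by apply: measurableC; apply: closed_measurable_mx; exact: closed_set0_rV.
  apply: closed_measurable_mx.
  by apply: closed_le_continuous; [exact: continuous_sqn|exact: cst_continuous].
by apply/seteqP; split => x /= [/eqP].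
Qed.

Lemma rv_leb_ball_lty m : (rv_leb m (@punctured_ball m) < +oo)%E.
Proof.
rewrite (@le_lt_trans _ _ (rv_leb m (box m (- 2) 1)))//; last first.
  by rewrite rv_leb_box; [rewrite ltry|lra].
apply: le_measure; rewrite ?inE//.
- exact: measurable_punctured_ball.
- exact: measurable_box.
- move=> x [_ x1] j; have := le_trans (sqr_coord_le_dot x j) x1.
  by rewrite expr2 => h; apply/andP; split; nra.
Qed.

Lemma rv_leb_ball_gt0 m : (0 < m)%N -> (0 < rv_leb m (punctured_ball m))%E.
Proof.
(* The box ]0, 1/m]^m lies in the punctured unit ball. *)
move=> m0; pose d : R := m%:R^-1.
have mR : (1 <= m%:R :> R) by rewrite ler1n.
have d0 : 0 < d by rewrite invr_gt0; lra.
have d1 : d <= 1 by rewrite invf_le1//; lra.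
apply: (@lt_le_trans _ _ (rv_leb m (box m 0 d))).
  by rewrite rv_leb_box; [rewrite subr0 lte_fin exprn_gt0|exact: ltW].
apply: le_measure; rewrite ?inE//.
- exact: measurable_box.
- exact: measurable_punctured_ball.
- move=> x bx; split.
    apply/eqP => x0; have := bx (Ordinal m0).
    by rewrite x0 mxE ltxx.
  rewrite dotE (@le_trans _ _ (\sum_(j < m) d))//.
    apply: ler_sum => j _; have /andP[h1 h2] := bx j.
    by rewrite (le_trans (ler_pM (ltW h1) (ltW h1) h2 h2))// ler_piMl// ltW.
  by rewrite sumr_const card_ord -mulr_natl /d mulfV//; lra.
Qed.

Lemma dot_orth m (U : 'M[R]_m) (x : 'rV[R]_m) : orthogonal_mx U ->
  dot (x *m U) (x *m U) = dot x x.
Proof. by move=> oU; rewrite dot_mulmx -mulmxA oU mulmx1. Qed.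

(** An orthogonal map sends the punctured ball to itself, and the volume of
    that ball is neither zero nor infinite, so the factor in rv_leb_linear is
    1. *)
Lemma rv_leb_orth m (U : 'M[R]_m) (A : set (borel_mx R 1 m)) : (0 < m)%N ->
  orthogonal_mx U ->
  measurable A -> rv_leb m [set x | A ((x : 'rV_m) *m U)] = rv_leb m A.
Proof.
move=> m0 oU mA.
have [uU _] := mulmx1_unit oU.
rewrite rv_leb_linear//.
set c := rv_leb m [set x | _].
suff -> : c = 1%E by rewrite mul1e.
have := rv_leb_linear uU (@measurable_punctured_ball m).
rewrite (_ : [set x | _] = punctured_ball m); last first.
  apply/seteqP; split => x /=; rewrite /punctured_ball/= dot_orth// => -[x0 ->].
    by split => //; apply: contraNneq x0 => ->; rewrite mul0mx.
  split => //; apply: contraNneq x0 => xU0.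
  by rewrite -(mulmxK uU x) xU0 mul0mx.
rewrite -/c.
move: (rv_leb_ball_gt0 m0) (rv_leb_ball_lty m).
have : (0 <= c)%E by exact: measure_ge0.
case: (rv_leb m _) => [k| |]//; case: c => [c| |]//=.
- rewrite -EFinM !lte_fin => c0 k0 _ [] kE.
  have k1 : k != 0 by rewrite gt_eqF.
  by congr EFin; apply: (mulIf k1); rewrite mul1r.
- rewrite lte_fin => _ k0 _; by rewrite gt0_mulye ?lte_fin.
Qed.

End rv_leb_invariance.
Arguments punctured_ball {R} m.

(** * Integrals characterized by two-sided bounds *)

Section sandwich.
Local Open Scope ereal_scope.
Context d (T : measurableType d) (R : realType).
Variables (rho : set T -> \bar R) (mu : {measure set T -> \bar R}).

Lemma nneseries_le_error (r s : nat -> \bar R) (D : set T) (A : nat -> set T)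
  (e : R) :
  (0 <= e)%R -> D = \bigcup_i A i -> (forall i, measurable (A i)) ->
  trivIset setT A -> (forall i, 0 <= r i) -> (forall i, 0 <= s i) ->
  (forall i, r i <= s i + e%:E * mu (A i)) ->
  \sum_(i <oo) r i <= \sum_(i <oo) s i + e%:E * mu D.
Proof.
move=> e0 DA mA tA r0 s0 rs.
rewrite DA measure_semi_bigcup//; last exact: bigcup_measurable.
rewrite -nneseriesZl// -nneseriesD//; last first.
  by move=> i _ _; rewrite mule_ge0// lee_fin.
exact: lee_nneseries.
Qed.

(** Cut D into the pieces on which F lies between i * e and (i + 1) * e. On
    each piece both sides are within e times the mass of the piece of each
    other, so on D they differ by at most e * mu D. The function rho is only
    assumed to be additive on D, since it is a measure in polar_volume and an
    integral in density_integral. *)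
Lemma sandwich_integral (D : set T) (F : T -> R) :
  measurable D -> mu D < +oo -> measurable_fun setT F ->
  (forall x, D x -> (0 <= F x)%R) ->
  (forall A, measurable A -> A `<=` D -> 0 <= rho A) ->
  (forall A : nat -> set T, (forall i, measurable (A i)) ->
    (forall i, A i `<=` D) -> trivIset setT A ->
    rho (\bigcup_i A i) = \sum_(i <oo) rho (A i)) ->
  (forall A (a : R), measurable A -> A `<=` D -> (0 < a)%R ->
    (forall x, A x -> (a <= F x)%R) -> a%:E * mu A <= rho A) ->
  (forall A (a : R), measurable A -> A `<=` D -> (0 < a)%R ->
    (forall x, A x -> (F x <= a)%R) -> rho A <= a%:E * mu A) ->
  rho D = \int[mu]_(x in D) (F x)%:E.
Proof.
move=> mD muD mF F0 rho0 rho_bigcup rho_ge rho_le.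
have key (e : R) : (0 < e)%R ->
    rho D <= \int[mu]_(x in D) (F x)%:E + e%:E * mu D /\
    \int[mu]_(x in D) (F x)%:E <= rho D + e%:E * mu D.
  move=> e0; pose A i := D `&` F @^-1` `[(i%:R * e)%R, (i.+1%:R * e)%R[.
  have ie0 (i : nat) : (0 <= i%:R * e)%R by rewrite mulr_ge0// ltW.
  have mA i : measurable (A i).
    by apply: measurableI => //; rewrite -[X in measurable X]setTI; exact: mF.
  have AP i x : A i x -> D x /\ (i%:R * e <= F x < i.+1%:R * e)%R.
    by rewrite /A/= in_itv/= => -[].
  have DA : D = \bigcup_i A i.
    apply/seteqP; split => [x Dx|x [i _ /AP[]]//].
    exists (Num.truncn (F x / e)%R) => //; split => //=.
    rewrite in_itv/= -ler_pdivlMr// -ltr_pdivrMr//.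
    by rewrite truncn_itv// divr_ge0 ?F0// ltW.
  have tA : trivIset setT A.
    apply/trivIsetP => i j _ _ ij; apply/seteqP; split => // x.
    move=> [/AP[Dx +] /AP[_]]; rewrite -!ler_pdivlMr// -!ltr_pdivrMr//.
    move=> /truncn_def hi /truncn_def hj.
    by move/eqP: ij; rewrite -hi -hj.
  have AD i : A i `<=` D by move=> x /AP[].
  have loI i : (i%:R * e)%:E * mu (A i) <= \int[mu]_(x in A i) (F x)%:E.
    rewrite -(integral_cst mu (mA i)); apply: ge0_le_integral => //.
    - by move=> x _; rewrite lee_fin ie0.
    - exact/measurable_EFinP/measurable_funTS.
    - by move=> x /AP[_ /andP[h _]]; rewrite lee_fin.
  have upI i : \int[mu]_(x in A i) (F x)%:E <= (i.+1%:R * e)%:E * mu (A i).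
    rewrite -(integral_cst mu (mA i)); apply: ge0_le_integral => //.
    - by move=> x /AP[Dx _]; rewrite lee_fin F0.
    - exact/measurable_EFinP/measurable_funTS.
    - by move=> x /AP[_ /andP[_ h]]; rewrite lee_fin ltW.
  have lo i : (i%:R * e)%:E * mu (A i) <= rho (A i).
    case: i => [|i]; first by rewrite mul0r mul0e; exact: rho0.
    by apply: rho_ge => //; [rewrite mulr_gt0|move=> x /AP[_ /andP[]]].
  have up i : rho (A i) <= (i.+1%:R * e)%:E * mu (A i).
    apply: rho_le => //; first by rewrite mulr_gt0.
    by move=> x /AP[_ /andP[_ h]]; exact: ltW.
  have step i : (i.+1%:R * e)%:E * mu (A i) =
      (i%:R * e)%:E * mu (A i) + e%:E * mu (A i).
    by rewrite -[in LHS]natr1 mulrDl mul1r EFinD ge0_muleDl// ?lee_fin ?ie0//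
      ltW.
  have rhoE : rho D = \sum_(i <oo) rho (A i).
    by rewrite {1}DA; exact: rho_bigcup.
  have intE : \int[mu]_(x in D) (F x)%:E =
      \sum_(i <oo) \int[mu]_(x in A i) (F x)%:E.
    rewrite {1}DA ge0_integral_bigcup//.
      exact/measurable_EFinP/measurable_funTS.
    by move=> x [i _ /AP[Dx _]]; rewrite lee_fin F0.
  have int_ge0 i : 0 <= \int[mu]_(x in A i) (F x)%:E.
    by apply: integral_ge0 => x /AP[Dx _]; rewrite lee_fin F0.
  have rhoA0 i : 0 <= rho (A i) by exact: rho0.
  rewrite rhoE intE; split; apply: (nneseries_le_error (A := A)) => //;
    try exact: ltW.
    by move=> i; rewrite (le_trans (up i))// step leeD2r.
  by move=> i; rewrite (le_trans (upI i))// step leeD2r.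
have small (e : R) : (0 < e)%R -> exists2 e', (0 < e')%R & e'%:E * mu D <= e%:E.
  move=> e0; have muf : mu D \is a fin_num by rewrite ge0_fin_numE.
  have m0 : (0 <= fine (mu D))%R by exact: fine_ge0.
  exists (e / (fine (mu D) + 1))%R; first by rewrite divr_gt0// ltr_wpDl.
  rewrite -(fineK muf) -EFinM lee_fin mulrAC ler_pdivrMr ?ltr_wpDl//.
  by rewrite ler_pM2l// lerDl.
apply/eqP; rewrite eq_le; apply/andP; split; apply/lee_addgt0Pr => e e0;
  have [e' e'0 he] := small _ e0; have [h1 h2] := key _ e'0.
- by rewrite (le_trans h1)// leeD2l.
- by rewrite (le_trans h2)// leeD2l.
Qed.

End sandwich.

(** * Radial projection onto the sphere *)

Section direction.
Variable R : realType.

(** Written with a power of the squared length, which makes measurability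
    immediate; the origin is sent to itself. *)
Definition dir n (x : 'rV[R]_n) : 'rV[R]_n := dot x x `^ (- 2^-1) *: x.

Lemma sqr_powR_Nhalf (r : R) : 0 < r -> (r `^ (- 2^-1)) ^+ 2 = r^-1.
Proof.
move=> r0; rewrite expr2 -powRD; last by rewrite (gt_eqF r0) implybT.
rewrite (_ : - 2^-1 + - 2^-1 = -1 :> R); last by field.
by rewrite powRN powRr1 ?ltW.
Qed.

Lemma dir_sphere n (x : 'rV[R]_n) : x != 0 -> dot (dir x) (dir x) = 1.
Proof.
move=> /dot_gt0 x0; rewrite /dir dotZl dotZr mulrA -expr2 sqr_powR_Nhalf//.
by rewrite mulVf// gt_eqF.
Qed.

Lemma dir_scale n (r : R) (x : 'rV[R]_n) : 0 < r -> dir (r *: x) = dir x.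
Proof.
move=> r0; rewrite /dir dotZl dotZr mulrA powRM ?mulr_ge0 ?dot_ge0 ?ltW//.
rewrite powRM ?ltW// -expr2 sqr_powR_Nhalf// scalerA; congr (_ *: _).
by field; rewrite gt_eqF.
Qed.

Lemma dir_orth n (U : 'M[R]_n) (x : 'rV[R]_n) : orthogonal_mx U ->
  dir (x *m U) = dir x *m U.
Proof. by move=> oU; rewrite /dir dot_orth// scalemxAl. Qed.

Lemma measurable_dir n : measurable_fun setT
  (@dir n : borel_mx R 1 n -> borel_mx R 1 n).
Proof.
apply: measurable_fun_mx => i j; rewrite /dir; under eq_fun do rewrite mxE.
apply: measurable_funM; last exact: measurable_coord.
apply: (measurableT_comp (measurable_powR (- 2^-1))).
by apply: continuous_measurable_mx_real; exact: continuous_sqn.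
Qed.

End direction.

(** * Orthonormal bases of subspaces *)

Section orthonormal_basis.
Variable R : realType.

(** Gram-Schmidt on projections: if u is a unit vector in the range of P, then
    P - u^T u is a projection of rank one less. *)
Lemma orthonormal_basis_exists n m (P : 'M[R]_n) : grassmannian R n m P ->
  exists B : 'M[R]_(m, n), is_orthonormal_basis P B.
Proof.
elim: m P => [|m IH] P [PT PP rP].
  have P0 : P = 0 by apply/eqP; rewrite -mxrank_eq0 rP.
  exists 0; split; last by rewrite mulmx0 P0.
  by apply/matrixP => -[].
have [u0 u0P u0n] : exists2 u : 'rV[R]_n, u *m P = u & u != 0.
  have /rowV0Pn[v vP v0] : P != 0 by rewrite -mxrank_eq0 rP.
  exists v => //; have /submxP[w ->] := vP; by rewrite -mulmxA PP.
pose u := dir u0.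
have uP : u *m P = u by rewrite /u /dir -scalemxAl u0P.
have uu : u *m u^T = 1%:M by apply/sphereE/dir_sphere.
have PuT : P *m u^T = u^T by rewrite -[in RHS]uP trmx_mul PT.
pose Q := P - u^T *m u.
have uQ : u *m Q = 0 by rewrite mulmxBr uP mulmxA uu mul1mx subrr.
have QT : Q^T = Q by rewrite linearB/= PT trmx_mul trmxK.
have PQ : P *m Q = Q by rewrite mulmxBr PP mulmxA PuT.
have QP : Q *m P = Q by rewrite mulmxBl PP -mulmxA uP.
have QQ : Q *m Q = Q by rewrite {1}/Q mulmxBl PQ -mulmxA uQ mulmx0 subr0.
have rQ : \rank Q = m.
  apply/eqP; rewrite eqn_leq; apply/andP; split.
    rewrite -ltnS -rP; apply: rank_ltmx; rewrite ltmxE.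
    rewrite -{1}QP submxMl/=; apply/negP => PQs.
    have /submxP[w uw] : (u <= Q)%MS by apply: submx_trans PQs;
      rewrite -uP submxMl.
    have u0' : u = 0 by rewrite uw -QQ mulmxA -uw uQ.
    move: uu; rewrite u0' mul0mx => /matrixP /(_ 0 0) /eqP.
    by rewrite !mxE eqxx eq_sym oner_eq0.
  have : (\rank P <= \rank Q + \rank (u^T *m u))%N.
    have -> : P = Q + u^T *m u by rewrite subrK.
    exact: mxrank_add.
  rewrite rP => h; have := leq_trans h
    (leq_add (leqnn _) (leq_trans (mxrankM_maxl _ _) (rank_leq_col _))).
  by rewrite addn1.
have [C [CC CQ]] := IH Q (And3 QT QQ rQ).
have uC : u *m C^T = 0.
  have : u *m C^T *m C = 0 by rewrite -mulmxA CQ.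
  move=> /(congr1 (mulmx^~ C^T)); by rewrite -!mulmxA CC mulmx1 mul0mx.
have Cu : C *m u^T = 0 by apply: (can_inj (@trmxK _ _ _));
  rewrite trmx_mul trmxK uC trmx0.
have BB : col_mx u C *m (col_mx u C)^T = 1%:M.
  by rewrite tr_col_mx mul_col_row uu CC uC Cu -scalar_mx_block.
have BP : (col_mx u C)^T *m col_mx u C = P.
  by rewrite tr_col_mx mul_row_col CQ /Q addrC subrK.
by exists (col_mx u C).
Qed.

End orthonormal_basis.

(** * Rotation-invariant measures on spheres and polar coordinates *)

Section haar.
Variable R : realType.
Variables (n m : nat) (P : 'M[R]_n) (B : 'M[R]_(m, n)).
Hypotheses (m0 : (0 < m)%N) (hB : is_orthonormal_basis P B).

Lemma basisP : B *m P = B.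
Proof. by case: hB => B1 <-; rewrite mulmxA B1 mul1mx. Qed.

Lemma basis_sub (y : 'rV[R]_m) : subspace_of P (y *m B).
Proof. by rewrite /subspace_of/= -mulmxA basisP. Qed.

Lemma dot_basis (y : 'rV[R]_m) : dot (y *m B) (y *m B) = dot y y.
Proof. by case: hB => B1 _; rewrite dot_mulmx -mulmxA B1 mulmx1. Qed.

Definition dir_in (y : 'rV[R]_m) : 'rV[R]_n := dir y *m B.

Lemma measurable_dir_in :
  measurable_fun setT (dir_in : borel_mx R 1 m -> borel_mx R 1 n).
Proof.
exact: (measurableT_comp (continuous_measurable_mx (@continuous_mulmx R m n B))
  (@measurable_dir R m)).
Qed.

Lemma measurable_dir_in_setI (A : set (borel_mx R 1 n))
  (C : set (borel_mx R 1 m)) :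
  measurable A -> measurable C ->
    measurable [set y : borel_mx R 1 m | A (dir_in y) /\ C y].
Proof.
move=> mA mC; have mdA := measurable_dir_in measurableT mA.
by rewrite setTI in mdA; exact: measurableI mdA mC.
Qed.

Definition cone_measure := image_measure measurable_dir_in
  (mrestr (rv_leb m) (@measurable_punctured_ball R m)).

Definition ball_volume : R := fine (rv_leb m (punctured_ball m)).

Lemma ball_volumeE : rv_leb m (punctured_ball m) = (ball_volume)%:E.
Proof. by rewrite fineK// ge0_fin_numE ?measure_ge0// rv_leb_ball_lty. Qed.

Lemma ball_volume_gt0 : 0 < ball_volume.
Proof. by rewrite -lte_fin -ball_volumeE rv_leb_ball_gt0. Qed.

(** The rotation-invariant probability measure on the unit sphere of the range
    of P, obtained by projecting the unit ball radially. The Dirac mass is the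
    value that normalization takes when the total mass vanishes or is
    infinite. *)
Definition haar_of_basis : probability (borel_mx R 1 n) R :=
  mnormalize cone_measure (dirac (0 : borel_mx R 1 n)).

Lemma haar_of_basisE (A : set (borel_mx R 1 n)) :
  haar_of_basis A =
  (rv_leb m [set y | A (dir_in y) /\ punctured_ball m y] *
    (ball_volume^-1)%:E)%E.
Proof.
rewrite /haar_of_basis /= /mnormalize /= /cone_measure /image_measure.
rewrite /pushforward /mrestr /= preimage_setT setTI ball_volumeE.
by rewrite eqe gt_eqF ?ball_volume_gt0.
Qed.

Lemma dir_in_sub y : y != 0 -> (sphere R n `&` subspace_of P) (dir_in y).
Proof.
by move=> y0; split; [apply/sphereE;
  rewrite dot_basis dir_sphere|exact: basis_sub].
Qed.

(** A rotation U of the subspace acts on coordinates as the orthogonal matrix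
    B U B^T, so invariance follows from rv_leb_orth. *)
Lemma is_haar_of_basis : is_haar_sphere P haar_of_basis.
Proof.
split.
  rewrite haar_of_basisE (_ : [set y | _] = punctured_ball m).
    by rewrite ball_volumeE -EFinM mulfV// gt_eqF// ball_volume_gt0.
  by apply/seteqP; split => y /=;
    [case|move=> yB; split => //; apply: dir_in_sub; case: yB].
move=> U oU UP A mA; rewrite !haar_of_basisE; congr (_ * _)%E.
pose V := B *m U *m B^T.
have BUP : B *m U *m P = B *m U.
  apply/row_matrixP => i; rewrite !row_mul.
  suff: subspace_of P (row i B *m U) by [].
  rewrite -UP; exists (row i B) => //; rewrite /subspace_of/=.
  by rewrite -row_mul basisP.
have VB : V *m B = B *m U.
  by rewrite /V -mulmxA (proj2 hB).
have oV : orthogonal_mx V.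
  have VT : V^T = B *m (U^T *m B^T) by rewrite /V !trmx_mul trmxK.
  by rewrite /orthogonal_mx VT mulmxA VB mulmxA -(mulmxA B) oU mulmx1
    (proj1 hB).
have mC : measurable [set y : borel_mx R 1 m | A (dir_in y) /\ punctured_ball m
  y].
  by apply: measurable_dir_in_setI => //; exact: measurable_punctured_ball.
rewrite -[RHS](rv_leb_orth m0 oV)//; congr (rv_leb m _).
apply/seteqP; split => y /=; rewrite /dir_in dir_orth//
  -[dir y *m V *m B]mulmxA VB mulmxA
  /punctured_ball/= dot_orth// => -[Ay [y0 y1]]; split=> //; split => //.
  apply: contraNneq y0 => /(congr1 (mulmx^~ V^T)).
  by rewrite -mulmxA oV mulmx1 mul0mx => ->.
by apply: contraNneq y0 => ->; rewrite mul0mx.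
Qed.

Lemma measurable_subspace (Q : 'M[R]_n) :
  measurable (subspace_of Q : set (borel_mx R 1 n)).
Proof.
rewrite (_ : subspace_of Q = [set x | x *m Q - x = 0]).
  apply: closed_measurable_mx.
  rewrite (_ : mkset _ = (fun x : 'rV[R]_n => x *m (Q - 1%:M)) @^-1` [set 0]).
    apply: closed_comp; last exact: closed_set0_rV.
    by move=> x _; exact: continuous_mulmx.
  by apply/seteqP; split => x /=; rewrite mulmxBr mulmx1.
by apply/seteqP; split => x /= => [->|/subr0_eq]; rewrite ?subrr.
Qed.

Lemma measurable_sphere : measurable (sphere R n : set (borel_mx R 1 n)).
Proof. by apply: closed_measurable_mx; exact: closed_sphere. Qed.

(** A sector of radius r^(1/m) is the sector of radius 1 scaled by r^(1/m), so
    its volume is multiplied by r. The radius is compared through 2m-th powers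
    to avoid roots of the squared length. *)
Lemma rv_leb_sector (A : set (borel_mx R 1 n)) (r : R) : 0 < r ->
  measurable A ->
  rv_leb m [set y | A (dir_in y) /\ y != 0 /\ dot y y ^+ m <= r ^+ 2] =
  (r%:E * rv_leb m [set y | A (dir_in y) /\ punctured_ball m y])%E.
Proof.
move=> r0 mA; pose q := r `^ (m%:R^-1).
have q0 : 0 < q by exact: powR_gt0.
have mR : m%:R != 0 :> R by rewrite pnatr_eq0 -lt0n.
have qm : q ^+ m = r.
  by rewrite -powR_mulrn ?ltW// /q -powRrM mulVf// powRr1// ltW.
have mC : measurable [set y : borel_mx R 1 m | A (dir_in y) /\ punctured_ball m
  y].
  by apply: measurable_dir_in_setI => //; exact: measurable_punctured_ball.
have q'0 : 0 < q^-1 by rewrite invr_gt0.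
have := rv_leb_scale q'0 mC; rewrite exprVn invrK qm => <-.
congr (rv_leb m _); apply/seteqP; split => y /=;
  rewrite /dir_in dir_scale// /punctured_ball/= dotZl dotZr mulrA -expr2 exprVn;
  rewrite mulrC ler_pdivrMr ?exprn_gt0// mul1r;
  (have -> : (q^-1 *: y != 0) = (y != 0) by rewrite scaler_eq0 invr_eq0 gt_eqF);
  move=> [Ay [y0 yr]]; split => //; split => //.
- rewrite -(@ler_pXn2r _ m) ?nnegrE ?dot_ge0 ?exprn_ge0 ?(ltW q0)//.
  by rewrite -exprM mulnC exprM qm.
- rewrite -qm -exprM mulnC exprM.
  by apply: lerXn2r; rewrite ?nnegrE ?dot_ge0 ?exprn_ge0 ?(ltW q0).
Qed.

(** Integration in polar coordinates for a star-shaped set with radial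
    function f^(1/m). On a set of directions where f is at least a (at most
    a), the set contains (is contained in) a sector whose volume is computed
    by rv_leb_sector, and sandwich_integral does the rest. *)
Lemma polar_volume (f : 'rV[R]_n -> R) :
  measurable_fun setT (f : borel_mx R 1 n -> R) ->
  (forall x, sphere R n x -> subspace_of P x -> 0 <= f x) ->
  rv_leb m [set y | y != 0 /\ dot y y ^+ m <= f (dir_in y) ^+ 2] =
  (\int[haar_of_basis]_(x in sphere R n `&` subspace_of P)
    (ball_volume * f x)%:E)%E.
Proof.
move=> mf f0; set D := _ `&` _.
have mD : measurable (D : set (borel_mx R 1 n)).
  by apply: measurableI; [exact: measurable_sphere|exact: measurable_subspace].
pose C := [set y : borel_mx R 1 m | (y : 'rV_m) != 0 /\ dot y y ^+ m <=
  f (dir_in y) ^+ 2].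
have mC : measurable C.
  have -> : C = ~` [set (0 : 'rV[R]_m)] `&`
      [set y | 0 <= f (dir_in y) ^+ 2 - dot y y ^+ m].
    by apply/seteqP; split => y /= -[/eqP y0]; rewrite subr_ge0.
  apply: measurableI.
    by apply: measurableC; apply: closed_measurable_mx; exact: closed_set0_rV.
  have mg : measurable_fun setT (fun y : borel_mx R 1 m =>
      f (dir_in y) ^+ 2 - dot (y : 'rV_m) y ^+ m).
    apply: measurable_funB; apply: measurable_funX.
      exact: (measurableT_comp mf measurable_dir_in).
    by apply: continuous_measurable_mx_real; exact: continuous_sqn.
  rewrite (_ : mkset _ = (fun y : borel_mx R 1 m =>
      f (dir_in y) ^+ 2 - dot (y : 'rV_m) y ^+ m) @^-1` `[0, +oo[).
    by rewrite -[X in measurable X]setTI; apply: mg.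
  by apply/seteqP; split => y /=; rewrite in_itv/= andbT.
pose rho := image_measure measurable_dir_in (mrestr (rv_leb m) mC).
have rhoE A : rho A = rv_leb m [set y | A (dir_in y) /\ C y] by [].
have <- : rho D = rv_leb m C.
  rewrite rhoE; congr (rv_leb m _); apply/seteqP; split => y /=; first by case.
  by move=> Cy; split => //; apply: dir_in_sub; case: Cy.
have kap0 := ball_volume_gt0.
have mS (A : set (borel_mx R 1 n)) r : measurable A -> measurable
    [set y : borel_mx R 1 m | A (dir_in y) /\ (y : 'rV_m) !=
      0 /\ dot y y ^+ m <= r].
  move=> mA.
  suff : measurable [set y : borel_mx R 1 m | (y : 'rV_m) !=
    0 /\ dot y y ^+ m <= r].
    exact: measurable_dir_in_setI.
  rewrite (_ : mkset _ =
      ~` [set (0 : 'rV[R]_m)] `&` [set y | dot y y ^+ m <= r]); last first.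
    by apply/seteqP; split => y /= -[/eqP].
  apply: measurableI.
    by apply: measurableC; apply: closed_measurable_mx; exact: closed_set0_rV.
  apply: closed_measurable_mx; apply: closed_le_continuous;
    last exact: cst_continuous.
  by apply: continuous_exp_fun; exact: continuous_sqn.
have scal (A : set (borel_mx R 1 n)) (a : R) : measurable A -> 0 < a ->
    (a%:E * haar_of_basis A)%E = rv_leb m
     [set y | A (dir_in y) /\ y != 0 /\ dot y y ^+ m <= (a / ball_volume) ^+ 2].
  move=> mA a0; rewrite rv_leb_sector// ?divr_gt0//.
  by rewrite haar_of_basisE EFinM [(rv_leb _ _ * _)%E]muleC muleA.
apply: (@sandwich_integral _ _ _ rho) => //.
- by rewrite (le_lt_trans (probability_le1 _ _))// ltry.
- by apply: measurable_funM => //; exact: measurable_cst.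
- by move=> x [xS xP]; rewrite mulr_ge0 ?f0// ltW.
- by move=> A mA AD tA; apply: (@measure_semi_bigcup _ _ _ rho) => //;
    exact: bigcup_measurable.
- move=> A a mA AD a0 af; rewrite scal//.
  suff : (rv_leb m [set y | A (dir_in y) /\ (y != 0 /\
      dot y y ^+ m <= (a / ball_volume) ^+ 2)%R] <=
      rv_leb m [set y | A (dir_in y) /\ C y])%E by [].
  apply: le_measure; rewrite ?inE.
  + exact: mS.
  + exact: measurable_dir_in_setI.
  + move=> y /= [Ay [y0 yle]]; split => //; split => //.
    have fy0 : 0 <= f (dir_in y) by have [? ?] := AD _ Ay; rewrite f0.
    have ak0 : 0 <= a / ball_volume by rewrite divr_ge0 ?(ltW a0) ?(ltW kap0).
    apply: (le_trans yle); rewrite ler_pXn2r//.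
    by rewrite ler_pdivrMr// mulrC af.
- move=> A a mA AD a0 af; rewrite scal//.
  suff : (rv_leb m [set y | A (dir_in y) /\ C y] <=
      rv_leb m [set y | A (dir_in y) /\ (y != 0 /\
      dot y y ^+ m <= (a / ball_volume) ^+ 2)%R])%E by [].
  apply: le_measure; rewrite ?inE.
  + exact: measurable_dir_in_setI.
  + exact: mS.
  + move=> y /= [Ay [y0 yle]]; split => //; split => //.
    have fy0 : 0 <= f (dir_in y) by have [? ?] := AD _ Ay; rewrite f0.
    have ak0 : 0 <= a / ball_volume by rewrite divr_ge0 ?(ltW a0) ?(ltW kap0).
    apply: (le_trans yle); rewrite ler_pXn2r//.
    by rewrite ler_pdivlMr// mulrC af.
Qed.

End haar.

(** * Moments of rotation-invariant measures *)

Section sphere_integrals.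
Variables (R : realType) (n : nat).

Lemma mx_norm_le (x : 'rV[R]_n) (M : R) : 0 <= M ->
  (forall j, `|x 0 j| <= M) -> `|x| <= M.
Proof.
move=> M0 xM; rewrite [leLHS]/Num.norm /= mx_normrE;
  apply: bigmax_le => // -[i j] _ /=.
by rewrite (ord1 i).
Qed.

Lemma coord_le_sphere (x : 'rV[R]_n) j : sphere R n x -> `|x 0 j| <= 1.
Proof.
move=> /sphereE x1; rewrite -(@ler_pXn2r _ 2) ?nnegrE// real_normK ?num_real//.
by rewrite expr1n -x1 sqr_coord_le_dot.
Qed.

Lemma compact_sphere : compact (sphere R n).
Proof.
apply: bounded_closed_compact; last exact: closed_sphere.
exists 1; split => // M M1 x xS; apply: mx_norm_le; first by lra.
by move=> j; rewrite (le_trans (coord_le_sphere j xS))// ltW.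
Qed.

Lemma sphere_integrable (mu : {finite_measure set (borel_mx R 1 n) -> \bar R})
    (D : set 'rV[R]_n) (g : 'rV[R]_n -> R) :
  measurable (D : set (borel_mx R 1 n)) -> D `<=` sphere R n -> continuous g ->
  mu.-integrable D (EFin \o g).
Proof.
move=> mD DS cg; apply: measurable_bounded_integrable => //.
- by rewrite -ge0_fin_numE ?fin_num_measure.
- by apply: measurable_funTS; exact: continuous_measurable_mx_real.
- have : compact (g @` sphere R n).
    apply: continuous_compact; last exact: compact_sphere.
    exact: continuous_subspaceT.
  move=> /compact_bounded [M [Mr HM]]; exists M; split => // N MN x Dx.
  by apply: HM => //; exists x => //; exact: DS.
Qed.

End sphere_integrals.

Lemma coef2_expr1pX2 (R : comNzRingType) k :
  ((1 + 'X^2 : {poly R}) ^+ k)`_2 = k%:R.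
Proof.
rewrite exprDn (eq_bigr (fun i : 'I_k.+1 => 'X^(2 * i) *+ 'C(k, i)));
  last first.
  by move=> i _; rewrite expr1n mul1r -exprM.
rewrite coef_sum; case: k => [|k].
  by rewrite big_ord_recl big_ord0 /= addr0 bin0 coefMn coefXn.
rewrite !big_ord_recl /= big1 => [|i _].
  by rewrite !coefMn !coefXn /= bin0 bin1 mulr1n add0r addr0.
rewrite coefMn coefXn /bump /= (_ : (2 == _)%N = false) ?mul0rn//.
by apply/eqP; lia.
Qed.

(** The field is infinite. *)
Lemma poly_eq_horner (R : realType) (p q : {poly R}) :
  (forall x, p.[x] = q.[x]) -> p = q.
Proof.
move=> pq; apply/eqP; rewrite -subr_eq0; apply/eqP.
apply: (@roots_geq_poly_eq0 _ _ [seq i%:R | i <- iota 0 (size (p - q)%R)]).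
- by apply/allP => x _; rewrite rootE !hornerE pq subrr.
- rewrite map_inj_uniq ?iota_uniq// => i j /eqP; rewrite eqr_nat => /eqP //.
- by rewrite size_map size_iota.
Qed.

Section reflection.
Variables (R : realType) (n : nat) (P : 'M[R]_n).
(** The reflection in the hyperplane orthogonal to u - v exchanges u and v,
    and it preserves every subspace that contains both. *)
Lemma reflection_exists (u v : 'rV[R]_n) :
  subspace_of P u -> subspace_of P v -> dot u u = dot v v ->
  exists U : 'M[R]_n, [/\ orthogonal_mx U,
    [set x *m U | x in subspace_of P] = subspace_of P & v *m U^T = u].
Proof.
move=> uP vP uv; have [->|nuv] := eqVneq u v.
  exists 1%:M; split; first by rewrite /orthogonal_mx trmx1 mulmx1.
    apply/seteqP; split => x /=; first by move=> [y yP <-]; rewrite mulmx1.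
    by exists x => //; rewrite mulmx1.
  by rewrite trmx1 mulmx1.
pose w := u - v.
have wP : w *m P = w by rewrite mulmxBl uP vP.
have w0 : dot w w != 0 by rewrite gt_eqF// dot_gt0// subr_eq0.
pose c := 2 / dot w w.
pose U := 1%:M - c *: (w^T *m w).
have xU (x : 'rV[R]_n) : x *m U = x - (c * dot x w) *: w.
  rewrite mulmxBr mulmx1 -scalemxAr mulmxA; congr (_ - _).
  by rewrite [x *m w^T]mx11_scalar -[_ 0 0]/(dot x w) mul_scalar_mx scalerA.
have UT : U^T = U by rewrite linearB/= trmx1 linearZ/= trmx_mul trmxK.
have UU (x : 'rV[R]_n) : x *m U *m U = x.
  rewrite xU xU dotDl dotNl dotZl (_ : c * (_ - _) = - (c * dot x w)).
    by rewrite scaleNr opprK subrK.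
  by rewrite /c; field.
have oU : orthogonal_mx U.
  rewrite /orthogonal_mx UT; apply/row_matrixP => i.
  by rewrite row_mul rowE UU rowE mulmx1.
have UP (x : 'rV[R]_n) : subspace_of P x -> subspace_of P (x *m U).
  by move=> xP; rewrite /subspace_of/= xU mulmxBl -scalemxAl wP xP.
exists U; split => //.
  apply/seteqP; split => x /=; first by move=> [y yP <-]; exact: UP.
  by move=> xP; exists (x *m U); [exact: UP|rewrite UU].
rewrite UT xU.
have dvw : dot v w = - (dot w w) / 2.
  by rewrite /w !dotDr !dotDl !dotNr !dotNl uv (dotC v u); field.
by rewrite dvw (_ : c * _ = -1);
  [rewrite scaleN1r opprK /w addrC subrK|rewrite /c; field].
Qed.

End reflection.

Section moments.
Variable R : realType.

(** The moments of <x, u>^2 for x uniform on the unit sphere of an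
    m-dimensional space and u a unit vector. *)
Fixpoint moment (m j : nat) : R :=
  if j is j'.+1 then moment m j' * (2 * j' + 1)%:R / (m + 2 * j')%:R else 1.

Lemma moment_gt0 m j : (0 < m)%N -> 0 < moment m j.
Proof.
move=> m0; elim: j => //= j IH; rewrite !mulr_gt0 ?invr_gt0 ?ltr0n//.
  by rewrite addn1.
by rewrite addn_gt0 m0.
Qed.

Variables (n m : nat) (P : 'M[R]_n) (B : 'M[R]_(m, n)).
Hypotheses (m0 : (0 < m)%N) (hB : is_orthonormal_basis P B).
Variables (sigma : probability (borel_mx R 1 n) R).
Hypothesis hsigma : is_haar_sphere P sigma.

Let D := sphere R n `&` subspace_of P.
Local Notation E g := (\int[sigma]_(x in D) g x)%R.

Let mD : measurable (D : set (borel_mx R 1 n)).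
Proof.
by apply: measurableI; [exact: measurable_sphere|exact: measurable_subspace].
Qed.

Let intE (g : 'rV[R]_n -> R) : continuous g -> sigma.-integrable D (EFin \o g).
Proof. by move=> cg; apply: sphere_integrable => // x []. Qed.

Let PT : P^T = P.
Proof. by case: hB => _ <-; rewrite trmx_mul trmxK. Qed.

Let PP : P *m P = P.
Proof. by case: hB => B1 <-; rewrite mulmxA -(mulmxA _ B) B1 mulmx1. Qed.

Let mU (U : 'M[R]_n) : measurable_fun setT
  ((fun x : 'rV[R]_n => x *m U) : borel_mx R 1 n -> borel_mx R 1 n).
Proof. exact: (continuous_measurable_mx (@continuous_mulmx R n n U)). Qed.

Let E_add (f g : 'rV[R]_n -> R) : continuous f -> continuous g ->
  E (fun x => f x + g x) = E f + E g.
Proof. by move=> cf cg; rewrite RintegralD//; exact: intE. Qed.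

Let E_scale (a : R) (f : 'rV[R]_n -> R) : continuous f ->
  E (fun x => a * f x) = a * E f.
Proof. by move=> cf; rewrite RintegralZl//; exact: intE. Qed.

Let E_cst (a : R) : E (fun=> a) = a.
Proof.
have sD : sigma D = 1%E by exact: proj1 hsigma.
transitivity (a * fine (sigma D)); first exact: Rintegral_cst.
by rewrite sD mulr1.
Qed.

Let E_sum (I : Type) (r : seq I) (F : I -> 'rV[R]_n -> R) :
  (forall i, continuous (F i)) ->
  E (fun x => \sum_(i <- r) F i x) = \sum_(i <- r) E (F i).
Proof.
move=> cF; elim: r => [|i r IH].
  by under eq_Rintegral do rewrite big_nil; rewrite big_nil E_cst.
under eq_Rintegral do rewrite big_cons.
by rewrite big_cons -IH E_add//; exact: continuous_sum.
Qed.

Let E_orth (U : 'M[R]_n) (g : 'rV[R]_n -> R) : orthogonal_mx U ->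
  [set x *m U | x in subspace_of P] = subspace_of P -> continuous g ->
  E (fun x => g (x *m U)) = E g.
Proof.
move=> oU UP cg; congr fine.
transitivity (\int[image_measure (mU U) sigma]_(x in D) (g x)%:E)%E; last first.
  by apply: eq_measure_integral => A mA _; apply: (proj2 hsigma).
have DU : (fun x : 'rV[R]_n => x *m U) @^-1` D = D.
  apply/seteqP; split => x /= [/sphereE xS xP]; split.
  - by apply/sphereE; rewrite -(dot_orth x oU); exact: xS.
  - have [y yP yx] : [set z *m U | z in subspace_of P] (x *m U) by rewrite UP.
    have [uU _] := mulmx1_unit oU.
    by rewrite -(can_inj (mulmxK uU) yx).
  - by apply/sphereE; rewrite dot_orth; last exact: oU; exact: xS.
  - by rewrite -UP; exists x => //; exact: xP.
rewrite (integral_pushforward (mU U))// ?DU//.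
- apply/measurable_EFinP; exact: continuous_measurable_mx_real.
- apply: (intE (g := fun x => g (x *m U))) => x.
  by apply: continuous_comp; [exact: continuous_mulmx|exact: cg].
Qed.

Let continuous_dotX u j : continuous (fun x : 'rV[R]_n => dot x u ^+ j).
Proof. by apply: continuous_exp_fun; exact: continuous_dot. Qed.

(** Apply a reflection that exchanges u and v. *)
Let E_dot_eq u v j : subspace_of P u -> subspace_of P v -> dot u u = dot v v ->
  E (fun x => dot x u ^+ j) = E (fun x => dot x v ^+ j).
Proof.
move=> uP vP uv; have [U [oU UP vU]] := reflection_exists uP vP uv.
rewrite -(E_orth oU UP (@continuous_dotX v j)).
by apply: eq_Rintegral => x _; rewrite dot_mulmx vU.
Qed.

Let e : 'rV[R]_n := row (Ordinal m0) B.
Let M j := E (fun x => dot x e ^+ (2 * j)).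

Let dot_row i j : dot (row i B) (row j B) = (i == j)%:R.
Proof. by case: hB => /matrixP /(_ i j); rewrite !mxE dotE => <- _;
  apply: eq_bigr => k _; rewrite !mxE. Qed.

Let rowP i : subspace_of P (row i B).
Proof. by rewrite /subspace_of/= -row_mul (basisP hB). Qed.

Let E_dot u j : subspace_of P u ->
  E (fun x => dot x u ^+ (2 * j)) = dot u u ^+ j * M j.
Proof.
move=> uP; pose s := Num.sqrt (dot u u).
have s2 : s ^+ 2 = dot u u by rewrite sqr_sqrtr// dot_ge0.
have seP : subspace_of P (s *: e) by rewrite /subspace_of/= -scalemxAl rowP.
rewrite (@E_dot_eq u (s *: e))//; last first.
  by rewrite dotZl dotZr mulrA -expr2 s2 dot_row eqxx mulr1.
under eq_Rintegral do rewrite dotZr exprMn.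
by rewrite E_scale// exprM s2.
Qed.

(** Both sides of E_dot for u + b v are polynomials in b; this is the
    coefficient of b^2. *)
Let E_dot_mixed u v j : subspace_of P u -> subspace_of P v ->
  dot u u = 1 -> dot v v = 1 -> dot u v = 0 ->
  E (fun x => dot x u ^+ (2 * j) * dot x v ^+ 2) = M j.+1 / (2 * j + 1)%:R.
Proof.
move=> uP vP u1 v1 uv.
pose c (i : nat) := E (fun x => dot x u ^+ (2 * j.+1 - i) * dot x v ^+ i).
have cc i : continuous (fun x : 'rV[R]_n =>
    dot x u ^+ (2 * j.+1 - i) * dot x v ^+ i).
  by apply: continuous_mul_fun; exact: continuous_dotX.
pose p : {poly R} := \poly_(i < (2 * j.+1).+1) (c i *+ 'C(2 * j.+1, i)).
have pE : p = M j.+1 *: (1 + 'X^2) ^+ j.+1.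
  apply: poly_eq_horner => b.
  have := @E_dot (u + b *: v) j.+1; rewrite !hornerE.
  rewrite dotDl !dotDr !dotZl !dotZr u1 v1 uv (dotC v u) uv.
  rewrite (_ : 1 + b * 0 + (b * 0 + b * (b * 1)) = 1 + b ^+ 2); last by ring.
  rewrite mulrC => <-; last by rewrite /subspace_of/= mulmxDl -scalemxAl uP vP.
  rewrite horner_poly.
  transitivity (E (fun x => \sum_(i < (2 * j.+1).+1)
    (b ^+ i *+ 'C(2 * j.+1, i)) *
      (dot x u ^+ (2 * j.+1 - i) * dot x v ^+ i))); last first.
    apply: eq_Rintegral => x _; rewrite dotDr dotZr exprDn; apply: eq_bigr =>
      i _.
    by rewrite exprMn mulrnAl; congr (_ *+ _); ring.
  rewrite E_sum; last first.
    by move=> i; apply: continuous_mul_fun; [exact: cst_continuous|exact: cc].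
  apply: eq_bigr => i _; rewrite E_scale// -/(c i).
  by rewrite !mulrnAl mulrC.
have := congr1 (fun q : {poly R} => q`_2) pE.
rewrite coefZ coef2_expr1pX2 coef_poly ifT; last by lia.
have -> : c 2 = E (fun x => dot x u ^+ (2 * j) * dot x v ^+ 2).
  by rewrite /c (_ : (2 * j.+1 - 2 = 2 * j)%N)//; lia.
rewrite bin2 -[LHS]mulr_natr => h.
have nz : ((2 * j + 1)%:R : R) != 0 by rewrite pnatr_eq0; lia.
have nz' : (j.+1%:R : R) != 0 by rewrite pnatr_eq0.
apply: (mulIf nz); rewrite divfK//; apply: (mulIf nz').
rewrite -h -mulrA -natrM; congr (_ * _%:R).
by rewrite mulnC (_ : (2 * j.+1).-1 = 2 * j + 1)%N; lia.
Qed.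

Let M0 : M 0 = 1.
Proof. by rewrite /M; under eq_Rintegral do rewrite expr0; exact: E_cst. Qed.

(** Insert the sum of the <x, e_i>^2 over an orthonormal basis, which is 1 on
    the sphere. *)
Let M_rec j : M j = M j.+1 * (m + 2 * j)%:R / (2 * j + 1)%:R.
Proof.
have nz : ((2 * j + 1)%:R : R) != 0 by rewrite pnatr_eq0; lia.
transitivity (E (fun x => \sum_i dot x e ^+ (2 * j) * dot x (row i B) ^+ 2)).
  apply: eq_Rintegral => x; rewrite inE => -[/sphereE x1 xP].
  rewrite -mulr_sumr -[LHS]mulr1; congr (_ * _).
  rewrite -x1 -{2}xP -(proj2 hB) mulmxA dotC dot_mulmx dotE.
  apply: eq_bigr => i _; rewrite expr2.
  suff -> : (x *m B^T) 0 i = dot x (row i B) by [].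
  by rewrite mxE dotE; apply: eq_bigr => k _; rewrite !mxE.
rewrite E_sum; last first.
  by move=> i; apply: continuous_mul_fun; exact: continuous_dotX.
rewrite (bigD1 (Ordinal m0))//=.
have -> : E (fun x => dot x e ^+ (2 * j) * dot x (row (Ordinal m0) B) ^+ 2) =
  M j.+1.
  by apply: eq_Rintegral => x _; rewrite -exprD mulnS addnC.
rewrite (eq_bigr (fun=> M j.+1 / (2 * j + 1)%:R)); last first.
  move=> i i0; apply: E_dot_mixed; rewrite ?/e; try exact: rowP.
  - by rewrite dot_row eqxx.
  - by rewrite dot_row eqxx.
  - by rewrite dot_row eq_sym (negbTE i0).
rewrite sumr_const (_ : #|_| = m.-1); last first.
  by rewrite cardC1 card_ord.
rewrite -mulr_natr.
have -> : (m + 2 * j)%:R = m.-1%:R + (2 * j + 1)%:R :> R by rewrite -natrD;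
  congr _%:R; lia.
by field.
Qed.

Let ME j : M j = moment m j.
Proof.
elim: j => [|j IH]; first exact: M0.
rewrite /= -IH [in RHS]M_rec.
have nz : ((2 * j + 1)%:R : R) != 0 by rewrite pnatr_eq0; lia.
have nz' : ((m + 2 * j)%:R : R) != 0 by rewrite pnatr_eq0; lia.
by rewrite divfK// mulfK.
Qed.

(** On the subspace the coordinate x_i is the inner product of x with the
    projection of the i-th basis vector, whose squared length is P_ii. Only
    the invariance of sigma is used, so the formula holds for whichever
    invariant measure was chosen as the Haar measure. *)
Lemma haar_moment (i0 : 'I_n) j :
  (\int[sigma]_(x in sphere R n `&` subspace_of P) ((x : 'rV_n) 0 i0 ^+ 2) ^+
    j)%R
  = moment m j * P i0 i0 ^+ j.
Proof.
pose u : 'rV[R]_n := delta_mx 0 i0 *m P.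
have uP : subspace_of P u by rewrite /subspace_of/= -mulmxA PP.
have uu : dot u u = P i0 i0.
  rewrite dot_mulmx PT -mulmxA PP dotC -rowE.
  by rewrite dot_delta mxE.
transitivity (E (fun x => dot x u ^+ (2 * j))).
  apply: eq_Rintegral => x; rewrite inE => -[_ xP].
  by rewrite exprM -{1}xP -dot_delta dot_mulmx PT.
by rewrite E_dot// uu ME mulrC.
Qed.

Lemma haar_horner (p : {poly R}) (i0 : 'I_n) (N : nat) : (size p <= N)%N ->
  (\int[sigma]_(x in sphere R n `&` subspace_of P) p.[(x : 'rV_n) 0 i0 ^+ 2])%R
  = \sum_(j < N) p`_j * (moment m j * P i0 i0 ^+ j).
Proof.
move=> sp; under eq_Rintegral do rewrite (horner_coef_wide _ sp).
have cX j : continuous (fun x : 'rV[R]_n => (x 0 i0 ^+ 2) ^+ j).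
  by do 2 apply: continuous_exp_fun; exact: coord_continuous.
rewrite E_sum; last first.
  by move=> j; apply: continuous_mul_fun; [exact: cst_continuous|exact: cX].
by apply: eq_bigr => j _; rewrite E_scale// haar_moment.
Qed.

End moments.

(** * A class of smooth functions closed under partial derivatives *)

Section smooth_functions.
Variables (R : realType) (n : nat).

(** Powers are the only construction that is not smooth everywhere, so their
    bases are required to be positive on U. *)
Inductive smooth_expr (U : set 'rV[R]_n) : ('rV[R]_n -> R) -> Prop :=
| SmoothCst c : smooth_expr U (fun=> c)
| SmoothCoord i : smooth_expr U (fun x => x 0 i)
| SmoothAdd f g : smooth_expr U f -> smooth_expr U g ->
    smooth_expr U (fun x => f x + g x)
| SmoothMul f g : smooth_expr U f -> smooth_expr U g ->
    smooth_expr U (fun x => f x * g x)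
| SmoothPow f p : smooth_expr U f -> (forall x, U x -> 0 < f x) ->
    smooth_expr U (fun x => f x `^ p).

Lemma smooth_expr_differentiable (U : set 'rV[R]_n) f x :
  smooth_expr U f -> U x -> differentiable f x.
Proof.
move=> sf Ux; elim: sf => {f} [c|i|f g _ df _ dg|f g _ df _ dg|f p _ df f0].
- exact: differentiable_cst.
- exact: differentiable_coord.
- exact: differentiableD.
- exact: differentiableM.
- apply: (@differentiable_comp _ _ _ _ f (fun t => t `^ p)) => //.
  by apply/derivable1_diffP; apply: derivable_powR; rewrite in_itv/= f0.
Qed.

Lemma derive_comp_real (f : 'rV[R]_n -> R) (g : R -> R) (x v : 'rV[R]_n) :
  differentiable f x -> derivable g (f x) 1 ->
  'D_v (g \o f) x = derive1 g (f x) * 'D_v f x.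
Proof.
move=> df /derivable1_diffP dg.
rewrite deriveE; last exact: differentiable_comp.
by rewrite diff_comp//= (diff1E dg) [in RHS]deriveE// mulrC.
Qed.

(** The derivative of f^p is p f^(p-1) f', which is again of the same form:
    this is what makes iterated derivatives accessible by induction. *)
Lemma smooth_expr_derive (U : set 'rV[R]_n) f (i : 'I_n) :
  smooth_expr U f ->
  exists2 g, smooth_expr U g & forall x, U x -> 'D_(delta_mx 0 i) f x = g x.
Proof.
have dif f x := @smooth_expr_differentiable U f x.
elim=> {f} [c|j|f g sf [f' sf' fE] sg [g' sg' gE]
    |f g sf [f' sf' fE] sg [g' sg' gE]|f p sf [f' sf' fE] f0].
- by exists (fun=> 0); [exact: SmoothCst|move=> x Ux; exact: derive_cst].
- exists (fun=> (j == i)%:R); first exact: SmoothCst.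
  move=> x Ux; rewrite /derive.
  apply/cvg_lim => //; apply: cvg_near_cst;
    apply: (filterS _ (nbhs_dnbhs_neq _)).
  move=> h h0 /=; rewrite !mxE addrK eqxx /=.
  by rewrite /GRing.scale/= mulrA mulVf// mul1r.
- exists (fun x => f' x + g' x); first exact: SmoothAdd.
  move=> x Ux; rewrite (deriveD (f := f) (g := g));
    try exact/diff_derivable/dif.
  by rewrite fE// gE.
- exists (fun x => f x * g' x + g x * f' x).
    by apply: SmoothAdd; apply: SmoothMul.
  move=> x Ux; rewrite (deriveM (f := f) (g := g));
    try exact/diff_derivable/dif.
  by rewrite fE// gE.
- exists (fun x => p * f x `^ (p - 1) * f' x).
    by apply: SmoothMul => //; apply: SmoothMul;
      [exact: SmoothCst|exact: SmoothPow].
  move=> x Ux; rewrite (@derive_comp_real f (fun t => t `^ p)) ?fE//.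
  + by rewrite powR_derive1// in_itv/= f0.
  + exact: dif.
  + by apply: derivable_powR; rewrite in_itv/= f0.
Qed.

Lemma smooth_expr_iter_partial (U : set 'rV[R]_n) f (s : seq 'I_n) :
  open U -> smooth_expr U f ->
  exists2 g, smooth_expr U g & forall x, U x -> iter_partial s f x = g x.
Proof.
move=> oU sf; elim: s => [|i s [g sg gE]]; first by exists f.
have [g' sg' g'E] := smooth_expr_derive i sg.
exists g' => // x Ux; rewrite -g'E//=; apply: near_eq_derive.
by apply: filterS (open_nbhs_nbhs (conj oU Ux)) => y; exact: gE.
Qed.

Lemma smooth_expr_smooth_on (U : set 'rV[R]_n) f :
  open U -> smooth_expr U f -> smooth_on U f.
Proof.
move=> oU sf s x Ux; have [g sg gE] := smooth_expr_iter_partial s oU sf.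
have near_g : \forall y \near x, g y = iter_partial s f y.
  by apply: filterS (open_nbhs_nbhs (conj oU Ux)) => y Uy; rewrite gE.
have dg := smooth_expr_differentiable sg Ux.
split => [|i].
  have cg : g y @[y --> x] --> g x by exact: differentiable_continuous dg.
  have : iter_partial s f y @[y --> x] --> g x.
    by apply: cvg_trans (near_eq_cvg near_g) cg.
  by rewrite -gE.
by apply: near_eq_derivable near_g _; exact: diff_derivable.
Qed.

End smooth_functions.

(** * Bodies of revolution with a quadratic profile *)

Section revolution_body.
Variables (R : realType) (n : nat) (i0 : 'I_n).

(** With e the basis vector of index i0, N = |x|^2 and z = 1 - <x, e>^2 / N,
    this is N^2 (a - b z + c z^2): the profile of the body, extended from the
    sphere to a polynomial of degree 4. *)
Definition quartic (a b c : R) (x : 'rV[R]_n) : R :=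
  a * dot x x ^+ 2 - b * (dot x x * (dot x x - x 0 i0 ^+ 2))
  + c * (dot x x - x 0 i0 ^+ 2) ^+ 2.

(** The polynomial a - b z + c z^2 with z = 1 - t, expanded in t. *)
Definition profile (a b c : R) : {poly R} :=
  (a - b + c)%:P + (b - 2 * c) *: 'X + c *: 'X^2.

(** The set |x|^(d+4) <= quartic x, squared so that it involves only
    polynomials. Since the quartic is homogeneous of degree 4, on the ray
    through a unit vector theta the condition reads r^d <= quartic theta, so
    the d-th power of the radial function is the profile. *)
Definition revolution_body (d : nat) (a b c : R) : set 'rV[R]_n :=
  [set x | dot x x ^+ (d + 4) <= quartic a b c x ^+ 2].

Lemma quartic_sphere a b c x : sphere R n x ->
  quartic a b c x = (profile a b c).[x 0 i0 ^+ 2].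
Proof.
move=> /sphereE x1; rewrite /quartic x1 /profile.
by rewrite !(hornerD, hornerN, hornerZ, hornerC, horner_exp, hornerX); ring.
Qed.

Lemma quarticZ a b c r x : quartic a b c (r *: x) = r ^+ 4 * quartic a b c x.
Proof. by rewrite /quartic dotZl dotZr mxE; ring. Qed.

Lemma continuous_quartic a b c : continuous (quartic a b c).
Proof.
have cN := @continuous_sqn R n.
have cx : continuous (fun x : 'rV[R]_n => x 0 i0) by exact: coord_continuous.
have cst (k : R) : continuous (fun _ : 'rV[R]_n => k) by exact: cst_continuous.
have cW : continuous (fun x : 'rV[R]_n => dot x x - x 0 i0 ^+ 2).
  by apply: continuous_sub_fun => //; exact: continuous_exp_fun.
apply: continuous_add_fun; last first.
  by apply: continuous_mul_fun => //; exact: continuous_exp_fun.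
apply: continuous_sub_fun; apply: continuous_mul_fun => //.
  exact: continuous_exp_fun.
exact: continuous_mul_fun.
Qed.

Lemma smooth_expr_quartic U a b c : smooth_expr U (quartic a b c).
Proof.
have sN : smooth_expr U (fun x => dot x x).
  rewrite (_ : (fun x => dot x x) = (fun x : 'rV[R]_n => \sum_j x 0 j * x 0 j)).
    elim: (index_enum _) => [|j r IH].
      by under eq_fun do rewrite big_nil; exact: SmoothCst.
    under eq_fun do rewrite big_cons.
    by apply: SmoothAdd => //; apply: SmoothMul; exact: SmoothCoord.
  by apply/funext => x; rewrite dotE.
have sN2 k : smooth_expr U (fun x => k * (dot x x * dot x x)).
  by apply: SmoothMul; [exact: SmoothCst|exact: SmoothMul].
have sW : smooth_expr U (fun x => dot x x + (-1) * (x 0 i0 * x 0 i0)).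
  apply: SmoothAdd => //; apply: SmoothMul; first exact: SmoothCst.
  by apply: SmoothMul; exact: SmoothCoord.
have := SmoothAdd (sN2 a) (SmoothAdd
  (SmoothMul (SmoothCst U (- b)) (SmoothMul sN sW))
  (SmoothMul (SmoothCst U c) (SmoothMul sW sW))).
rewrite (_ : (fun _ => _) = quartic a b c)//.
by apply/funext => x; rewrite /quartic; ring.
Qed.

Variables (d : nat) (a b c : R).
Hypotheses (d0 : (0 < d)%N) (b0 : 0 <= b) (c0 : 0 < c)
  (disc : b ^+ 2 < 4 * a * c).

Let delta := a - b ^+ 2 / (4 * c).

Let delta_gt0 : 0 < delta.
Proof.
by rewrite subr_gt0 ltr_pdivrMr ?mulr_gt0// mulrCA mulrA.
Qed.

Let a0 : 0 < a.
Proof.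
rewrite (lt_le_trans delta_gt0)// /delta lerBlDr lerDl.
by rewrite divr_ge0 ?sqr_ge0// mulr_ge0// ltW.
Qed.

(** Completing the square: the bound is the minimum of a - b z + c z^2. *)
Lemma quartic_ge x : delta * dot x x ^+ 2 <= quartic a b c x.
Proof.
rewrite -subr_ge0 /quartic; set N := dot x x; set W := N - _.
have -> : a * N ^+ 2 - b * (N * W) + c * W ^+ 2 - delta * N ^+ 2 =
    c * (W - b * N / (2 * c)) ^+ 2.
  by rewrite /delta; field; rewrite gt_eqF.
by rewrite mulr_ge0 ?sqr_ge0// ltW.
Qed.

Lemma quartic_le x : quartic a b c x <= (a + c) * dot x x ^+ 2.
Proof.
rewrite /quartic; set N := dot x x; set t := x 0 i0 ^+ 2.
have tN : t <= N by exact: sqr_coord_le_dot.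
have t0 : 0 <= t by exact: sqr_ge0.
have h1 : 0 <= b * (N * (N - t)) by rewrite !mulr_ge0 ?dot_ge0 ?subr_ge0.
have h2 : c * (N - t) ^+ 2 <= c * N ^+ 2.
  by rewrite ler_pM2l// ler_pXn2r ?nnegrE ?subr_ge0 ?dot_ge0// lerBlDr lerDl.
lra.
Qed.

Lemma quartic_gt0 x : sphere R n x -> 0 < quartic a b c x.
Proof.
move=> /sphereE x1; apply: lt_le_trans (quartic_ge x).
by rewrite x1 expr1n mulr1.
Qed.

Lemma profile_gt0 x : sphere R n x -> 0 < (profile a b c).[x 0 i0 ^+ 2].
Proof. by move=> xS; rewrite -quartic_sphere// quartic_gt0. Qed.

Lemma quartic_ge0 x : 0 <= quartic a b c x.
Proof.
by apply: le_trans (quartic_ge x); rewrite mulr_ge0 ?sqr_ge0// ltW.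
Qed.

Let K := revolution_body d a b c.

(** On the ray through theta the body is the segment where r^(2d) is at most
    the square of the quartic. *)
Lemma radial_revolution_body theta : sphere R n theta ->
  radial K theta = quartic a b c theta `^ d%:R^-1.
Proof.
move=> tS; set q := quartic a b c theta; set rho := q `^ _.
have q0 : 0 < q by exact: quartic_gt0.
have rho0 : 0 < rho by exact: powR_gt0.
have dR : d%:R != 0 :> R by rewrite pnatr_eq0 -lt0n.
have rhod : rho ^+ d = q.
  by rewrite -powR_mulrn ?(ltW rho0)// /rho -powRrM mulVf// powRr1// ltW.
have t1 : dot theta theta = 1 by exact/sphereE.
have KE r : 0 <= r -> K (r *: theta) <-> r <= rho.
  move=> r0; rewrite /K /revolution_body/= quarticZ -/q dotZl dotZr t1 mulr1.
  have -> : ((r * r) ^+ (d + 4) <= (r ^+ 4 * q) ^+ 2) =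
      (r ^+ 8 * (r ^+ d) ^+ 2 <= r ^+ 8 * q ^+ 2).
    congr (_ <= _); last by ring.
    by rewrite -expr2 -!exprM -!exprD; congr (_ ^+ _); lia.
  move: r0; rewrite le_eqVlt => /predU1P[<-|r0].
    by rewrite expr0n/= !mul0r lexx; split => // _; exact: ltW.
  rewrite ler_pM2l ?exprn_gt0// ler_pXn2r ?nnegrE ?exprn_ge0 ?(ltW r0)
    ?(ltW q0)//.
  by rewrite -rhod ler_pXn2r ?nnegrE ?(ltW r0) ?(ltW rho0).
rewrite /radial; apply/eqP; rewrite eq_le; apply/andP; split.
  by apply: ge_sup; [exists 0; split => //; apply/KE => //; exact: ltW|move=>
    r [r0 /KE]; exact].
apply: ub_le_sup; first by exists rho => r [r0 /KE]; exact.
by split; [exact: ltW|apply/KE => //; exact: ltW].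
Qed.

Lemma radial_pow theta : sphere R n theta ->
  radial K theta ^+ d = (profile a b c).[theta 0 i0 ^+ 2].
Proof.
move=> tS; rewrite radial_revolution_body// -quartic_sphere//.
have q0 := quartic_gt0 tS.
rewrite -powR_mulrn ?powR_ge0// -powRrM mulVf ?powRr1 ?ltW//.
by rewrite pnatr_eq0 -lt0n.
Qed.

Let U := [set x | 0 < quartic a b c x].

Let open_U : open U.
Proof.
rewrite (_ : U = quartic a b c @^-1` [set r | 0 < r])//.
by apply: open_comp; [move=> x _; exact: continuous_quartic|exact: open_gt].
Qed.

Let smooth_radial : smooth_expr U (fun x => quartic a b c x `^ d%:R^-1).
Proof. by apply: SmoothPow => //; exact: smooth_expr_quartic. Qed.

Lemma smooth_revolution_body : infinitely_smooth K.
Proof.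
move=> theta tS; exists U, (fun x => quartic a b c x `^ d%:R^-1); split => //.
- exact: quartic_gt0.
- exact: smooth_expr_smooth_on open_U smooth_radial.
- by move=> x _ xS; rewrite radial_revolution_body.
Qed.

Lemma revolution_revolution_body : body_of_revolution K.
Proof.
exists (delta_mx 0 i0).
  by apply/sphereE; rewrite dot_delta mxE !eqxx.
move=> V oV eV theta tS.
have tVS : sphere R n (theta *m V) by apply/sphereE; rewrite dot_orth//;
  exact/sphereE.
rewrite !radial_revolution_body// !quartic_sphere//.
suff -> : (theta *m V) 0 i0 = theta 0 i0 by [].
rewrite -(dot_delta (theta *m V)) -(dot_delta theta) dot_mulmx; congr dot.
by rewrite -{1}eV -mulmxA oV mulmx1.
Qed.

Lemma closed_revolution_body : closed K.
Proof.
apply: closed_le_continuous; apply: continuous_exp_fun.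
  exact: continuous_sqn.
exact: continuous_quartic.
Qed.

Lemma compact_revolution_body : compact K.
Proof.
apply: bounded_closed_compact; last exact: closed_revolution_body.
pose M := 1 + (a + c) ^+ 2.
have M1 : 1 <= M by rewrite lerDl sqr_ge0.
exists M; split => [|L ML x xK]; first exact: num_real.
(* For N > 1 the inequality N^(d+4) <= ((a + c) N^2)^2 bounds N^d, hence N. *)
have NM : dot x x <= M.
  have [N1|N1] := leP (dot x x) 1; first exact: le_trans M1.
  have N4 : 0 < dot x x ^+ 4 by rewrite exprn_gt0// (lt_trans ltr01).
  have : dot x x ^+ d * dot x x ^+ 4 <= (a + c) ^+ 2 * dot x x ^+ 4.
    rewrite -exprD (le_trans xK)//.
    rewrite (_ : (a + c) ^+ 2 * dot x x ^+ 4 = ((a + c) * dot x x ^+ 2) ^+ 2);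
      last by ring.
    rewrite ler_pXn2r ?nnegrE ?quartic_ge0 ?quartic_le//.
    by rewrite mulr_ge0 ?sqr_ge0// addr_ge0// ltW.
  rewrite ler_pM2r// => Nd.
  apply: (@le_trans _ _ (dot x x ^+ d)).
    by rewrite -{1}(expr1 (dot x x)) ler_weXn2l// ltW.
  by rewrite (le_trans Nd)// lerDr.
apply: mx_norm_le; first by lra.
move=> j; apply: (@le_trans _ _ M); last exact: ltW.
rewrite -(@ler_pXn2r _ 2) ?nnegrE ?(le_trans ler01 M1)// real_normK ?num_real//.
rewrite (le_trans (sqr_coord_le_dot x j))// (le_trans NM)//.
by rewrite expr2 ler_peMl// (le_trans ler01).
Qed.

Lemma star_revolution_body : star_body K.
Proof.
split.
- exact: compact_revolution_body.
(* If N < e then N^d <= N < delta^2, hence N^(d+4) <= (delta N^2)^2. *)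
- exists 0; pose e := Num.min 1 (delta ^+ 2).
  have e0 : 0 < e by rewrite lt_min ltr01 exprn_gt0.
  have oB : open [set x : 'rV[R]_n | dot x x < e].
    rewrite (_ : mkset _ = (fun x : 'rV[R]_n => dot x x) @^-1`
      [set r | r < e])//.
    by apply: open_comp; [move=> x _; exact: continuous_sqn|exact: open_lt].
  have B0 : [set x : 'rV[R]_n | dot x x < e] 0 by rewrite /= dot0l.
  apply: filterS (open_nbhs_nbhs (conj oB B0)) => x /=.
  rewrite lt_min => /andP[N1 Nd].
  rewrite /K /revolution_body/= exprD.
  apply: (@le_trans _ _ ((delta * dot x x ^+ 2) ^+ 2)); last first.
    rewrite ler_pXn2r ?nnegrE ?quartic_ge0 ?quartic_ge//.
    by rewrite mulr_ge0 ?sqr_ge0// ltW.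
  rewrite exprMn -exprM ler_wpM2r ?exprn_ge0 ?dot_ge0//.
  apply: le_trans (ltW Nd); case: d d0 => // d' _.
  by rewrite exprS ler_piMr ?dot_ge0// exprn_ile1 ?dot_ge0 ?(ltW N1).
- have KN x : K x -> K (- x).
    rewrite /K /revolution_body/= -scaleN1r quarticZ dotZl dotZr.
    by rewrite mulN1r mulN1r opprK -signr_odd expr0 mul1r.
  apply/seteqP; split => x /=; first by move=> [y Ky <-]; exact: KN.
  by move=> Kx; exists (- x); [exact: KN|rewrite opprK].
- move=> t /andP[t0 t1] _ [x Kx <-]; move: Kx; rewrite /K /revolution_body/=.
  rewrite quarticZ dotZl dotZr mulrA exprMn [X in _ -> _ <= X]exprMn => Kx.
  apply: ler_pM => //; rewrite ?exprn_ge0 ?dot_ge0 ?mulr_ge0//.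
  rewrite -expr2 -!exprM; apply: ler_wiXn2l => //.
  by lia.
- split.
    move=> theta tS; have mtS : sphere R n (- theta).
      by apply/sphereE; rewrite dotNl dotNr opprK; exact/sphereE.
    rewrite !radial_revolution_body// !quartic_sphere// mxE sqrrN//.
  have cr : {in sphere R n, continuous (fun x => quartic a b c x `^ d%:R^-1)}.
    move=> x; rewrite inE => xS.
    apply: differentiable_continuous;
      apply: (smooth_expr_differentiable smooth_radial).
    exact: quartic_gt0.
  apply: subspace_eq_continuous (continuous_in_subspaceT cr).
  by move=> x /set_mem xS; apply/esym; exact: radial_revolution_body.
Qed.

End revolution_body.

(** * Volumes of central sections *)

Section section_volume.
Variables (R : realType) (n : nat) (i0 : 'I_n).

Lemma rank_orthocompl m (H : 'M[R]_n) : (m <= n)%N ->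
  grassmannian R n (n - m) H -> grassmannian R n m (orthocompl H).
Proof.
move=> mn [HT HH rH]; rewrite /orthocompl; split.
- by rewrite linearB/= trmx1 HT.
- by rewrite mulmxBl mulmxBr mulmxBr !mul1mx mulmx1 HH subrr subr0.
- have -> : \rank (1%:M - H) = \rank (kermx H).
    apply: eqmx_rank; apply/andP; split.
      by rewrite sub_kermx mulmxBl mul1mx HH subrr.
    apply/submxP; exists (kermx H).
    by rewrite mulmxBr mulmx1 mulmx_ker subr0.
  by rewrite mxrank_ker rH subKn.
Qed.

(** The mean of the profile over the unit sphere of an m-dimensional subspace,
    when t is the squared length of the projection of the axis onto it. *)
Definition section_mean (m : nat) (a b c t : R) : R :=
  (a - b + c) + (b - 2 * c) * (t / m%:R) + c *
    (3 * t ^+ 2 / (m%:R * (m%:R + 2))).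

Lemma size_profile (a b c : R) : (size (profile a b c) <= 3)%N.
Proof.
rewrite /profile (leq_trans (size_polyD _ _))// geq_max; apply/andP; split.
  rewrite (leq_trans (size_polyD _ _))// geq_max; apply/andP; split.
    by rewrite (leq_trans (size_polyC_leq1 _)).
  by rewrite (leq_trans (size_scale_leq _ _))// size_polyX.
by rewrite (leq_trans (size_scale_leq _ _))// size_polyXn.
Qed.

Lemma coef_profile (a b c : R) :
  [/\ (profile a b c)`_0 = a - b + c, (profile a b c)`_1 = b - 2 * c &
      (profile a b c)`_2 = c].
Proof. by rewrite /profile; split; rewrite !coefE /=; ring. Qed.

Lemma haar_profile m (P : 'M[R]_n) (B : 'M[R]_(m, n))
    (sigma : probability (borel_mx R 1 n) R) a b c :
  (0 < m)%N -> is_orthonormal_basis P B -> is_haar_sphere P sigma ->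
  (\int[sigma]_(x in sphere R n `&` subspace_of P)
     (profile a b c).[(x : 'rV_n) 0 i0 ^+ 2])%R
  = section_mean m a b c (P i0 i0).
Proof.
move=> m0 hB hs; rewrite (haar_horner m0 hB hs i0 (size_profile a b c)).
have [p0 p1 p2] := coef_profile a b c.
rewrite !big_ord_recl big_ord0 /= /bump /= !addn0 !add1n p0 p1 p2.
have mR : 0 < m%:R :> R by rewrite ltr0n.
rewrite /section_mean natrD; field; rewrite !gt_eqF//; lra.
Qed.

(** The section is cut out, up to the origin, by the radial function of
    polar_volume, because the quartic is homogeneous; the integral of the
    profile is then given by the first two moments. *)
Lemma section_volume m (P : 'M[R]_n) (a b c : R) : (0 < m)%N ->
  grassmannian R n m P -> 0 < c -> b ^+ 2 < 4 * a * c ->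
  subspace_volume m P (revolution_body i0 m a b c `&` subspace_of P) =
  (ball_volume R m * section_mean m a b c (P i0 i0))%:E.
Proof.
move=> m0 gP c0 disc; rewrite /subspace_volume.
set B := xget _ _.
have hB : is_orthonormal_basis P B.
  by have := xgetPex 0 (orthonormal_basis_exists gP).
set K := revolution_body i0 m a b c.
have KE : [set y : 'rV[R]_m | (K `&` subspace_of P) (y *m B)] =
    [set y : 'rV[R]_m | K (y *m B)].
  by apply/seteqP; split => y /=;
    [case|move=> Ky; split => //; exact: basis_sub hB _].
rewrite KE.
have mK : measurable ([set y : 'rV[R]_m | K (y *m B)] : set (borel_mx R 1 m)).
  apply: closed_measurable_mx.
  apply: (@closed_comp _ _ (fun y : 'rV[R]_m => y *m B) K).
    by move=> y _; exact: continuous_mulmx.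
  exact: closed_revolution_body.
rewrite -rv_lebE//.
pose C := [set y : 'rV[R]_m | y != 0 /\
  dot y y ^+ m <= quartic i0 a b c (dir_in B y) ^+ 2].
have KyE (y : 'rV[R]_m) : y != 0 ->
    K (y *m B) <-> dot y y ^+ m <= quartic i0 a b c (dir_in B y) ^+ 2.
  move=> /dot_gt0 N0; rewrite /K /revolution_body/= (dot_basis hB).
  rewrite /dir_in /dir -scalemxAl quarticZ exprMn.
  rewrite (_ : _ ^+ 4 ^+ 2 = (dot y y ^+ 4)^-1); last first.
    by rewrite -exprM (_ : 4 * 2 = 2 * 4)%N// exprM sqr_powR_Nhalf// exprVn.
  by rewrite mulrC ler_pdivlMr ?exprn_gt0// -exprD.
have KC : [set y : 'rV[R]_m | K (y *m B)] = [set 0] `|` C.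
  apply/seteqP; split => y /=.
    have [->|y0] := eqVneq y 0; first by left.
    by move=> /(KyE _ y0); right.
  move=> [->|[y0]]; last by move/(KyE _ y0).
  by rewrite mul0mx /K /revolution_body/= dot0l addn4 expr0n sqr_ge0.
have m00 : measurable ([set 0] : set (borel_mx R 1 m)).
  by apply: closed_measurable_mx; exact: closed_set0_rV.
have CE : C = [set y : 'rV[R]_m | K (y *m B)] `\` [set 0].
  rewrite KC; apply/seteqP; split => y /=.
    by move=> Cy; split; [right|case: Cy => /eqP].
  by move=> [[->|//] /(_ erefl)].
have mC : measurable (C : set (borel_mx R 1 m)) by rewrite CE;
  exact: measurableD.
rewrite KC; transitivity (rv_leb m [set 0%R : 'rV[R]_m] + rv_leb m C)%E.
  apply: measureU => //.
  by apply/seteqP; split => // y [-> []]; rewrite eqxx.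
rewrite rv_leb_set0// add0e.
have mq : measurable_fun setT (quartic i0 a b c : borel_mx R 1 n -> R).
  by apply: continuous_measurable_mx_real; exact: continuous_quartic.
rewrite (polar_volume m0 hB mq); last first.
  by move=> x xS _; rewrite ltW// (quartic_gt0 i0 c0 disc xS).
set D := _ `&` _; set sg := haar_of_basis _.
have mD : measurable (D : set (borel_mx R 1 n)).
  by apply: measurableI; [exact: measurable_sphere|exact: measurable_subspace].
have int : sg.-integrable D (EFin \o
  (fun x => ball_volume R m * quartic i0 a b c x)).
  apply: sphere_integrable => //; first by move=> x [].
  apply: continuous_mul_fun; [exact: cst_continuous|exact: continuous_quartic].
rewrite -[LHS]fineK ?(integrable_fin_num mD int)//; congr EFin.
rewrite -/(Rintegral sg D (fun x => ball_volume R m * quartic i0 a b c x)).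
rewrite RintegralZl//; last first.
  by apply: sphere_integrable => //; [move=> x []|exact: continuous_quartic].
congr (_ * _); rewrite -(haar_profile a b c m0 hB (is_haar_of_basis m0 hB)).
by apply: eq_Rintegral => x; rewrite inE => -[xS _]; exact: quartic_sphere.
Qed.

End section_volume.

(** * The counterexample and its dual body *)

Section witness.
Variables (R : realType) (n : nat).

(** Together with witness_lin and witness_quad for l = k, the coefficients of
    the mean of q(y) = (y - 1/2)^2 - 1/(4 n^2) at y = 1 - z b, when b has the
    Beta distribution with parameters l/2 and (n - 1 - l)/2: the constant is
    1/4 - 1/(4 n^2), and the two others are the first two moments of b. *)
Definition witness_cst : R := (1 - (n%:R ^+ 2)^-1) / 4.
Definition witness_lin (l : nat) : R := l%:R / (n%:R - 1).
Definition witness_quad (l : nat) : R :=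
  l%:R * (l%:R + 2) / ((n%:R - 1) * (n%:R + 1)).

Lemma witness_lin_ge0 l : (2 <= n)%N -> 0 <= witness_lin l.
Proof.
by move=> n2; rewrite divr_ge0// subr_ge0 ler1n (leq_trans _ n2).
Qed.

Lemma witness_quad_gt0 l : (2 <= n)%N -> (0 < l)%N -> 0 < witness_quad l.
Proof.
move=> n2 l0; have lR : 0 < l%:R :> R by rewrite ltr0n.
have nR : 2 <= n%:R :> R by rewrite ler_nat.
by rewrite /witness_quad divr_gt0// mulr_gt0//; lra.
Qed.

(** The minimum of a - b z + c z^2 is a - b^2 / (4 c), so this inequality
    makes the averages of q positive although q is not. After clearing
    denominators the difference is a positive multiple of l ((n - 2 - l)(2n -
    1) + n), and this is where l <= n - 2 matters. *)
Lemma witness_disc l : (0 < l)%N -> (l <= n - 2)%N -> (4 <= n)%N ->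
  witness_lin l ^+ 2 < 4 * witness_cst * witness_quad l.
Proof.
move=> l0 ln n4.
have lR : 0 < l%:R :> R by rewrite ltr0n.
have nR : 4 <= n%:R :> R by rewrite ler_nat.
have lnR : l%:R + 2 <= n%:R :> R by rewrite -natrD ler_nat; lia.
rewrite /witness_lin /witness_cst /witness_quad.
set x : R := l%:R in lR lnR *; set y : R := n%:R in nR lnR *.
have -> : 4 * ((1 - (y ^+ 2)^-1) / 4) * (x * (x + 2) / ((y - 1) * (y + 1))) =
    x * (x + 2) / y ^+ 2 by field; rewrite !gt_eqF//; lra.
rewrite expr_div_n ltr_pdivrMr; last by rewrite exprn_gt0//; lra.
rewrite mulrAC ltr_pdivlMr; last by rewrite exprn_gt0//; lra.
rewrite -subr_gt0.
have -> : x * (x + 2) * (y - 1) ^+ 2 - x ^+ 2 * y ^+ 2 =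
    x * ((y - 2 - x) * (2 * y - 1) + y) by ring.
rewrite mulr_gt0// ltr_wpDl//; last by lra.
by rewrite mulr_ge0//; lra.
Qed.

(** The left side is the mean of rho_K^k over the unit sphere of H^perp and,
    up to a constant factor, the right side is the mean of rho_L^(n-k) over
    the unit sphere of H, where L is the dual body and l = n - k. They agree
    because the two functions are dual transforms of mu_q and of its image
    under complementation, and the mean of R_{n-k}^*(mu) over the sphere of
    H^perp is the mean of R_k^*(mu^perp) over the sphere of H; for a quadratic
    q this is an identity between rational functions of k, l and s. *)
Lemma section_mean_witness k l s : (0 < k)%N -> (0 < l)%N -> n = (k + l)%N ->
  section_mean k witness_cst (witness_lin k) (witness_quad k) (1 - s) =
  section_mean l witness_cst (witness_lin l) (witness_quad l) s.
Proof.
move=> k0 l0 nE; rewrite /section_mean /witness_cst /witness_lin /witness_quad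
  nE.
rewrite natrD.
have kR : 1 <= k%:R :> R by rewrite ler1n.
have lR : 1 <= l%:R :> R by rewrite ler1n.
set x : R := k%:R in kR *; set y : R := l%:R in lR *.
by field; rewrite !gt_eqF//; lra.
Qed.

Lemma section_meanZ m (C a b c t : R) :
  section_mean m (C * a) (C * b) (C * c) t = C * section_mean m a b c t.
Proof. by rewrite /section_mean; ring. Qed.

Variables (k : nat) (i0 : 'I_n).
Hypotheses (n4 : (4 <= n)%N) (k2 : (2 <= k)%N) (kn : (k <= n - 2)%N).

Definition witness : set 'rV[R]_n :=
  revolution_body i0 k witness_cst (witness_lin k) (witness_quad k).

Let C := ball_volume R k / ball_volume R (n - k).

(** The constant C makes up for the volumes of unit balls in dimensions k and
    n - k. *)
Let dual_witness : set 'rV[R]_n :=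
  revolution_body i0 (n - k) (C * witness_cst) (C * witness_lin (n - k))
    (C * witness_quad (n - k)).

Let k0 : (0 < k)%N. Proof. by lia. Qed.
Let l0 : (0 < n - k)%N. Proof. by lia. Qed.
Let n2 : (2 <= n)%N. Proof. by lia. Qed.
Let ln : (n - k <= n - 2)%N. Proof. by lia. Qed.

Let C0 : 0 < C.
Proof. by rewrite divr_gt0// ball_volume_gt0. Qed.

Let disc_dual : (C * witness_lin (n - k)) ^+ 2 <
  4 * (C * witness_cst) * (C * witness_quad (n - k)).
Proof.
rewrite exprMn [ltRHS](_ : _ =
  C ^+ 2 * (4 * witness_cst * witness_quad (n - k))).
  by rewrite ltr_pM2l ?exprn_gt0// witness_disc.
by ring.
Qed.

Lemma star_witness : star_body witness.
Proof.
apply: star_revolution_body => //.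
- exact: witness_lin_ge0.
- exact: witness_quad_gt0.
- exact: witness_disc.
Qed.

Lemma smooth_witness : infinitely_smooth witness.
Proof.
by apply: smooth_revolution_body => //;
  [exact: witness_lin_ge0|exact: witness_quad_gt0|exact: witness_disc].
Qed.

Lemma revolution_witness : body_of_revolution witness.
Proof.
by apply: revolution_revolution_body => //;
  [exact: witness_lin_ge0|exact: witness_quad_gt0|exact: witness_disc].
Qed.

Let star_dual_witness : star_body dual_witness.
Proof.
apply: star_revolution_body => //.
- by rewrite mulr_ge0 ?(ltW C0)// witness_lin_ge0.
- by rewrite mulr_gt0// witness_quad_gt0.
Qed.

Let intersection_witness : intersection_body_of k witness dual_witness.
Proof.
move=> H gH; have gH' : grassmannian R n k (orthocompl H).
  by apply: rank_orthocompl => //; lia.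
have cl0 : 0 < C * witness_quad (n - k) by rewrite mulr_gt0// witness_quad_gt0.
rewrite (section_volume i0 k0 gH' (witness_quad_gt0 n2 k0)
  (witness_disc k0 kn n4)).
rewrite (section_volume i0 l0 gH cl0 disc_dual).
have -> : orthocompl H i0 i0 = 1 - H i0 i0 by rewrite /orthocompl !mxE eqxx.
rewrite (@section_mean_witness k (n - k))//; last by rewrite subnKC//; lia.
rewrite section_meanZ mulrA /C mulrCA mulfV ?mulr1//.
by rewrite gt_eqF// ball_volume_gt0.
Qed.

Lemma radial_dist_refl (K : set 'rV[R]_n) : radial_dist K K = 0.
Proof.
rewrite /radial_dist (_ : image _ _ = [set 0]) ?sup1//.
apply/seteqP; split => r /=; first by move=> [x _ <-]; rewrite subrr normr0.
move=> ->; exists (delta_mx 0 i0); last by rewrite subrr normr0.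
by apply/sphereE; rewrite dot_delta mxE !eqxx.
Qed.

Lemma witness_intersection_bodies : intersection_bodies R n k witness.
Proof.
split; first exact: star_witness.
exists (fun=> witness), (fun=> dual_witness); split.
  by move=> i; split; [exact: star_witness|exact: star_dual_witness|
    exact: intersection_witness].
by rewrite (_ : (fun=> _) = cst (0 : R));
  [exact: cvg_cst|apply/funext => i; exact: radial_dist_refl].
Qed.

End witness.

(** * Linear functionals given by moments *)

Section moment_functional.
Variable R : realType.

(** The expectation of p(y) when w lists the moments of y. *)
Definition moment_functional (w : nat -> R) (p : {poly R}) : R :=
  \sum_(j < size p) p`_j * w j.

Lemma moment_functional_wide N w (p : {poly R}) : (size p <= N)%N ->
  moment_functional w p = \sum_(j < N) p`_j * w j.
Proof.
move=> sN; rewrite /moment_functional -(subnKC sN) big_split_ord /=.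
rewrite [X in _ = _ + X]big1 ?addr0// => i _.
by rewrite nth_default ?mul0r// leq_addr.
Qed.

Lemma moment_functionalD w p q :
  moment_functional w (p + q) = moment_functional w p + moment_functional w q.
Proof.
pose N := maxn (size p) (size q).
rewrite (@moment_functional_wide N _ p) ?leq_maxl//.
rewrite (@moment_functional_wide N _ q) ?leq_maxr//.
rewrite (@moment_functional_wide N) ?size_polyD// -big_split/=.
by apply: eq_bigr => j _; rewrite coefD mulrDl.
Qed.

Lemma moment_functionalZ w c p :
  moment_functional w (c *: p) = c * moment_functional w p.
Proof.
rewrite (@moment_functional_wide (size p)) ?size_scale_leq// mulr_sumr.
by apply: eq_bigr => j _; rewrite coefZ mulrA.
Qed.

Lemma moment_functionalMX w p :
  moment_functional w (p * 'X) = moment_functional (fun j => w j.+1) p.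
Proof.
rewrite (@moment_functional_wide (size p).+1); last first.
  by have [->|p0] := eqVneq p 0; rewrite ?mul0r ?size_poly0// size_mulX.
rewrite big_ord_recl coefMX mul0r add0r.
by apply: eq_bigr => j _; rewrite coefMX.
Qed.

Lemma moment_functional_quadratic w p (a b c : R) :
  moment_functional w (p * (a%:P + b *: 'X + c *: 'X^2)) =
  moment_functional (fun j => a * w j + b * w j.+1 + c * w j.+2) p.
Proof.
have -> : p * (a%:P + b *: 'X + c *: 'X^2) =
    a *: p + b *: (p * 'X) + c *: (p * 'X * 'X).
  by rewrite !mulrDr -!scalerAr mulrC mul_polyC expr2 mulrA.
rewrite !moment_functionalD !moment_functionalZ !moment_functionalMX.
rewrite /moment_functional !mulr_sumr -!big_split/=.
by apply: eq_bigr => j _; ring.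
Qed.

Lemma moment_functional_poly w v (p : {poly R}) :
  moment_functional w (\poly_(j < size p) (p`_j * v j)) =
  moment_functional (fun j => v j * w j) p.
Proof.
rewrite (@moment_functional_wide (size p)) ?size_poly//.
by apply: eq_bigr => j _; rewrite coef_poly ltn_ord mulrA.
Qed.

End moment_functional.

Section beta_moments.
Variables (R : realType) (l k : nat).
Hypotheses (l0 : (0 < l)%N) (k0 : (0 < k)%N).
Let n := (l + k)%N.

(** The moments of the Beta distribution with parameters l/2 and k/2: for x
    uniform on the sphere of R^(l+k), this is the distribution of the squared
    length of the projection of x onto an l-dimensional subspace, equivalently
    of P_ii for a random P of rank l. *)
Definition beta_moment (j : nat) : R := moment R n j / moment R l j.

Let lR : 0 < l%:R :> R. Proof. by rewrite ltr0n. Qed.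
Let kR : 0 < k%:R :> R. Proof. by rewrite ltr0n. Qed.
Let n0 : (0 < n)%N. Proof. by rewrite addn_gt0 l0. Qed.
Let nR : n%:R = l%:R + k%:R :> R. Proof. by rewrite natrD. Qed.

Lemma beta_moment_rec j :
  beta_moment j.+1 = beta_moment j * (l%:R + 2 * j%:R) / (n%:R + 2 * j%:R).
Proof.
have [lp kp] := (lR, kR); rewrite /beta_moment /= !natrD !addr0.
have h1 : moment R n j != 0 by rewrite gt_eqF// moment_gt0.
have h2 : moment R l j != 0 by rewrite gt_eqF// moment_gt0.
have h3 : 0 <= j%:R :> R by [].
by field; rewrite h2 !gt_eqF//; lra.
Qed.

(** The expectation of y^a (1 - y)^b, which satisfies the recursions of the
    Beta function. *)
Definition beta_functional (a b : nat) : R :=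
  moment_functional beta_moment ('X^a * (1 - 'X) ^+ b).

Lemma beta_functional0 a : beta_functional a 0 = beta_moment a.
Proof.
rewrite /beta_functional expr0 mulr1 (@moment_functional_wide _ a.+1);
  last first.
  by rewrite size_polyXn.
rewrite big_ord_recr /= coefXn eqxx mul1r big1 ?add0r// => j _.
by rewrite coefXn /= ltn_eqF ?mul0r// ltn_ord.
Qed.

Lemma beta_functionalS a b :
  beta_functional a b.+1 = beta_functional a b - beta_functional a.+1 b.
Proof.
rewrite /beta_functional.
have -> : 'X^a * (1 - 'X) ^+ b.+1 =
    'X^a * (1 - 'X) ^+ b + (-1) *: ('X^(a.+1) * (1 - 'X) ^+ b) :> {poly R}.
  by rewrite scaleN1r exprS exprSr; ring.
by rewrite moment_functionalD moment_functionalZ mulN1r.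
Qed.

(** By induction on b, since both sides satisfy the difference equation
    beta_functionalS. *)
Lemma beta_functional_recl a b : beta_functional a.+1 b =
  beta_functional a b * (l%:R + 2 * a%:R) / (n%:R + 2 * a%:R + 2 * b%:R).
Proof.
elim: b a => [|b IH] a; first by rewrite !beta_functional0 beta_moment_rec
  mulr0 addr0.
have [lp kp] := (lR, kR); have aR : 0 <= a%:R :> R by [].
have bR : 0 <= b%:R :> R by [].
rewrite !beta_functionalS !IH -!(natr1 a) -!(natr1 b) nR.
by field; rewrite !gt_eqF//; lra.
Qed.

Lemma beta_functional_recr a b : beta_functional a b.+1 =
  beta_functional a b * (k%:R + 2 * b%:R) / (n%:R + 2 * a%:R + 2 * b%:R).
Proof.
have [lp kp] := (lR, kR); have aR : 0 <= a%:R :> R by [].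
have bR : 0 <= b%:R :> R by [].
rewrite beta_functionalS beta_functional_recl nR.
by field; rewrite !gt_eqF//; lra.
Qed.

Lemma beta_functional_gt0 a b : 0 < beta_functional a b.
Proof.
have [lp kp] := (lR, kR); have aR : 0 <= a%:R :> R by [].
elim: b => [|b IH].
  by rewrite beta_functional0 divr_gt0// moment_gt0.
have bR : 0 <= b%:R :> R by [].
rewrite beta_functional_recr nR divr_gt0// ?mulr_gt0//; lra.
Qed.

Lemma beta_functional_diag N : beta_functional N.+1 N.+1 =
  beta_functional N N * ((k%:R + 2 * N%:R) * (l%:R + 2 * N%:R)) /
  ((n%:R + 4 * N%:R) * (n%:R + 4 * N%:R + 2)).
Proof.
have [lp kp] := (lR, kR); have NR : 0 <= N%:R :> R by [].
rewrite beta_functional_recl beta_functional_recr -!(natr1 N) nR.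
by field; rewrite !gt_eqF//; lra.
Qed.

(** As N grows, y^N (1 - y)^N concentrates near y = 1/2, so the quotient of
    the two values tends to 1/4, with an error of order 1/N. The constant
    witness_cst falls short of 1/4 by 1/(4 n^2), and N = n^2 is already large
    enough. *)
Lemma beta_functional_neg N : (4 <= n)%N -> N = (n ^ 2)%N ->
  witness_cst R n * beta_functional N N < beta_functional N.+1 N.+1.
Proof.
move=> n4 NE; rewrite beta_functional_diag.
have n4R : 4 <= n%:R :> R by rewrite ler_nat.
rewrite mulrC -mulrA ltr_pM2l ?beta_functional_gt0//.
have [lp kp] := (lR, kR); rewrite /witness_cst NE natrX nR.
rewrite nR in n4R.
set x : R := l%:R in lp n4R *; set y : R := k%:R in kp n4R *.
have h0 : 0 < x + y by lra.
have h2 : 16 <= (x + y) ^+ 2 by nra.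
rewrite ltr_pdivlMr; last by rewrite mulr_gt0//; lra.
rewrite -subr_gt0.
set s := x + y in h0 h2 n4R *.
have -> : (y + 2 * s ^+ 2) * (x + 2 * s ^+ 2) -
    (1 - (s ^+ 2)^-1) / 4 * ((s + 4 * s ^+ 2) * (s + 4 * s ^+ 2 + 2)) =
    x * y + (1 / 4) * (7 * s ^+ 2 + 6 * s + 9 + 2 / s).
  by rewrite /s; field; rewrite gt_eqF.
have h3 : 0 < s^-1 by rewrite invr_gt0.
have h4 : 0 < x * y by rewrite mulr_gt0.
by rewrite addr_gt0//; lra.
Qed.

End beta_moments.

(** * Integration against a measure with a density *)

Section density.
Variables (R : realType) (n : nat).
Variables (sigma : probability (borel_mx R 1 n) R)
  (nu : {finite_measure set (borel_mx R 1 n) -> \bar R})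
  (w : 'rV[R]_n -> R).
Hypotheses (cw : continuous w) (w0 : forall x, sphere R n x -> 0 <= w x).
Hypothesis nuE : forall A : set (borel_mx R 1 n), measurable A ->
  nu A = (\int[sigma]_(x in sphere R n `&` A) (w x)%:E)%E.

Let S := sphere R n.
Let mS : measurable (S : set (borel_mx R 1 n)) := @measurable_sphere R n.

Let mf (g : 'rV[R]_n -> R) (A : set (borel_mx R 1 n)) : continuous g ->
  measurable_fun A (fun x => (g x)%:E).
Proof.
move=> cg; apply/measurable_EFinP; apply: measurable_funTS.
exact: continuous_measurable_mx_real.
Qed.

Let nuS (A : set (borel_mx R 1 n)) : measurable A -> A `<=` S ->
  (nu : {measure set (borel_mx R 1 n) -> \bar R}) A =
  (\int[sigma]_(x in A) (w x)%:E)%E.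
Proof. by move=> mA AS; rewrite [LHS]nuE// (_ : _ `&` A = A)//;
  exact/setIidPr. Qed.

Let density_integral_ge0 (g : 'rV[R]_n -> R) : continuous g ->
  (forall x, S x -> 0 <= g x) ->
  (\int[nu]_(x in S) (g x)%:E = \int[sigma]_(x in S) (g x * w x)%:E)%E.
Proof.
move=> cg g0; have cgw := continuous_mul_fun cg cw.
apply/esym.
apply: (@sandwich_integral _ _ _
  (fun A => \int[sigma]_(x in A) (g x * w x)%:E)%E).
- exact: mS.
- by rewrite -ge0_fin_numE ?fin_num_measure.
- exact: continuous_measurable_mx_real.
- exact: g0.
- move=> A mA AS; apply: integral_ge0 => x /AS xS.
  by rewrite lee_fin mulr_ge0 ?g0 ?w0.
- move=> A mA AS tA; apply: ge0_integral_bigcup => //; first exact: mf.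
  by move=> x [i _ /AS xS]; rewrite lee_fin mulr_ge0 ?g0 ?w0.
- move=> A a mA AS a0 ag; rewrite nuS//.
  rewrite -ge0_integralZl_EFin ?(ltW a0)//; first last.
    exact: mf.
    by move=> x /AS xS; rewrite lee_fin w0.
  apply: ge0_le_integral => //.
  + by move=> x /AS xS; rewrite lee_fin mulr_ge0 ?w0// ltW.
  + by apply: (@mf (fun x => a * w x)); apply: continuous_mul_fun => //;
      exact: cst_continuous.
  + exact: mf.
  + by move=> x Ax; rewrite lee_fin ler_wpM2r ?ag// w0//; exact: AS.
- move=> A a mA AS a0 ag; rewrite nuS//.
  rewrite -ge0_integralZl_EFin ?(ltW a0)//; first last.
    exact: mf.
    by move=> x /AS xS; rewrite lee_fin w0.
  apply: ge0_le_integral => //.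
  + by move=> x /AS xS; rewrite lee_fin mulr_ge0 ?g0 ?w0.
  + exact: mf.
  + by apply: (@mf (fun x => a * w x)); apply: continuous_mul_fun => //;
      exact: cst_continuous.
  + by move=> x Ax; rewrite lee_fin ler_wpM2r ?ag// w0//; exact: AS.
Qed.

Let sI (mu : {finite_measure set (borel_mx R 1 n) -> \bar R})
  (g : 'rV[R]_n -> R) : continuous g -> mu.-integrable S (EFin \o g).
Proof. by move=> cg; apply: sphere_integrable. Qed.

(** For non-negative functions this is sandwich_integral; a constant is added
    to a general function to make it non-negative on the sphere. *)
Lemma density_integral (g : 'rV[R]_n -> R) : continuous g ->
  (\int[nu]_(x in sphere R n) g x)%R =
  (\int[sigma]_(x in sphere R n) (g x * w x))%R.
Proof.
move=> cg; have [C C0 gC] : exists2 C, 0 <= C & forall x, S x -> `|g x| <= C.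
  have : compact (g @` S).
    apply: continuous_compact; last exact: compact_sphere.
    exact: continuous_subspaceT.
  move=> /compact_bounded [M [Mr HM]]; exists (`|M| + 1);
    first by rewrite addr_ge0.
  move=> x Sx; apply: (HM (`|M| + 1)); last by exists x.
  by rewrite ltr_pwDr// ler_norm.
have cC : continuous (fun _ : 'rV[R]_n => C) by exact: cst_continuous.
have cgC := continuous_add_fun cg cC.
have cgw := continuous_mul_fun cg cw.
have cCw := continuous_mul_fun cC cw.
have E1 : (\int[nu]_(x in S) (g x + C))%R =
  (\int[sigma]_(x in S) ((g x + C) * w x))%R.
  congr fine; apply: density_integral_ge0 => // x Sx.
  by rewrite -lerBlDr sub0r; have := gC x Sx; rewrite ler_norml => /andP[].
have E2 : (\int[nu]_(x in S) C)%R = (\int[sigma]_(x in S) (C * w x))%R.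
  by congr fine; apply: density_integral_ge0.
move: E1; rewrite RintegralD//; try exact: sI; rewrite E2.
under [in RHS]eq_Rintegral do rewrite mulrDl.
rewrite RintegralD//; try exact: (sI sigma).
exact: addIr.
Qed.

End density.

(** * The counterexample is not a Busemann-Petty body *)

Section not_busemann_petty.
Variables (R : realType) (n : nat).

Lemma haar_sphereP m (P : 'M[R]_n) : (0 < m)%N -> grassmannian R n m P ->
  is_haar_sphere P (haar_sphere P).
Proof.
move=> m0 /orthonormal_basis_exists[B hB].
have : [set sigma | is_haar_sphere P sigma] (haar_sphere P).
  by apply: getPex; exists (haar_of_basis B); exact: (is_haar_of_basis m0 hB).
by [].
Qed.

(** The entry P_ii is the squared length of the i-th row of P, hence at least
    P_ii^2. *)
Lemma grassmannian_diag m (P : 'M[R]_n) (i : 'I_n) :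
  grassmannian R n m P -> 0 <= P i i <= 1.
Proof.
move=> [PT PP _]; have PE : P i i = \sum_j P i j ^+ 2.
  rewrite -[in LHS]PP mxE; apply: eq_bigr => j _.
  by rewrite expr2 -[in X in _ * X]PT mxE.
have P0 : 0 <= P i i by rewrite PE sumr_ge0// => j _; exact: sqr_ge0.
have P2 : P i i ^+ 2 <= P i i.
  by rewrite {2}PE (bigD1 i)//= lerDl sumr_ge0// => j _; exact: sqr_ge0.
by rewrite P0/=; nra.
Qed.

Lemma radon_horner m (P : 'M[R]_n) (i0 : 'I_n) (p : {poly R}) :
  (0 < m)%N -> grassmannian R n m P ->
  radon_transform (fun x => p.[x 0 i0 ^+ 2]) P =
  moment_functional (fun j => moment R m j * P i0 i0 ^+ j) p.
Proof.
move=> m0 gP; have [B hB] := orthonormal_basis_exists gP.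
exact: (haar_horner m0 hB (haar_sphereP m0 gP)).
Qed.

Variables (k : nat) (i0 : 'I_n).
Hypotheses (n4 : (4 <= n)%N) (k2 : (2 <= k)%N) (kn : (k <= n - 2)%N).

Let l := (n - k)%N.
Let l0 : (0 < l)%N. Proof. by rewrite /l; lia. Qed.
Let k0 : (0 < k)%N. Proof. by lia. Qed.
Let n2 : (2 <= n)%N. Proof. by lia. Qed.
Let nE : n = (l + k)%N. Proof. by rewrite /l subnK//; lia. Qed.

(** Non-negative on [0, 1] and concentrated near 1/2, where q is negative. *)
Let bump_poly : {poly R} := 'X^(n ^ 2) * (1 - 'X) ^+ (n ^ 2).

Let test_poly : {poly R} :=
  \poly_(j < size bump_poly) (bump_poly`_j * (moment R l j)^-1).

(** The Radon transform multiplies the coefficients by the moments in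
    dimension l, which undoes the division in test_poly and leaves bump_poly
    at P_ii. *)
Lemma radon_test_ge0 P : grassmannian R n l P ->
  0 <= radon_transform (fun x => test_poly.[x 0 i0 ^+ 2]) P.
Proof.
move=> gP; rewrite (radon_horner i0 _ l0 gP) moment_functional_poly.
have -> : moment_functional
    (fun j => (moment R l j)^-1 * (moment R l j * P i0 i0 ^+ j)) bump_poly =
    bump_poly.[P i0 i0].
  rewrite horner_coef; apply: eq_bigr => j _.
  by rewrite mulKf// gt_eqF// moment_gt0.
have /andP[P0 P1] := grassmannian_diag i0 gP.
rewrite /bump_poly hornerM !horner_exp hornerX -polyC1 hornerD hornerN hornerC
  hornerX.
by rewrite mulr_ge0// exprn_ge0// subr_ge0.
Qed.

(** Dividing the coefficients of bump_poly by the moments in dimension l turns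
    the moments in dimension n into Beta moments, and multiplication by the
    profile then becomes multiplication by witness_cst - y + y^2, which is
    q. *)
Lemma test_profile_functional :
  moment_functional (moment R n)
    (test_poly * profile (witness_cst R n) (witness_lin R n k)
      (witness_quad R n k)) =
  witness_cst R n * beta_functional R l k (n ^ 2) (n ^ 2)
  - beta_functional R l k (n ^ 2).+1 (n ^ 2).+1.
Proof.
rewrite /profile moment_functional_quadratic moment_functional_poly.
have wE j : (moment R l j)^-1 *
   ((witness_cst R n - witness_lin R n k + witness_quad R n k) * moment R n j
    + (witness_lin R n k - 2 * witness_quad R n k) * moment R n j.+1
    + witness_quad R n k * moment R n j.+2) =
   witness_cst R n * beta_moment R l k j + (-1) * beta_moment R l k j.+1
    + 1 * beta_moment R l k j.+2.
  rewrite !beta_moment_rec// /beta_moment -nE /= !natrD /=.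
  have h1 : moment R l j != 0 by rewrite gt_eqF// moment_gt0.
  have jR : 0 <= j%:R :> R by [].
  have lR : 1 <= l%:R :> R by rewrite ler1n.
  have kR : 1 <= k%:R :> R by rewrite ler1n.
  rewrite /witness_lin /witness_quad -(natr1 j).
  have nR : n%:R = l%:R + k%:R :> R by rewrite {1}nE natrD.
  rewrite nR.
  by field; rewrite h1 !gt_eqF//; lra.
rewrite (_ : moment_functional _ bump_poly = moment_functional (fun j =>
   witness_cst R n * beta_moment R l k j + (-1) * beta_moment R l k j.+1
    + 1 * beta_moment R l k j.+2) bump_poly); last first.
  by apply: eq_bigr => j _; rewrite wE.
rewrite -moment_functional_quadratic.
have -> : bump_poly * ((witness_cst R n)%:P + (-1) *: 'X + 1 *: 'X^2) =
    witness_cst R n *: bump_poly +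
    (-1) *: ('X^((n ^ 2).+1) * (1 - 'X) ^+ (n ^ 2).+1).
  rewrite /bump_poly !scaleN1r scale1r -mul_polyC !exprS; ring.
by rewrite moment_functionalD !moment_functionalZ mulN1r.
Qed.

(** If rho_K^k were the dual transform of a non-negative measure, its integral
    against the test function would be an integral of a non-negative Radon
    transform. But it is the expectation of bump_poly times q under the Beta
    distribution, which is negative. *)
Lemma witness_not_busemann_petty : ~ busemann_petty_bodies R n k (witness k i0).
Proof.
move=> [_ [mu [nu [dens dual]]]].
pose h (x : 'rV[R]_n) := test_poly.[x 0 i0 ^+ 2].
pose prof := profile (witness_cst R n) (witness_lin R n k) (witness_quad R n k).
have cpoly (p : {poly R}) : continuous (fun x : 'rV[R]_n => p.[x 0 i0 ^+ 2]).
  move=> x; apply: (@continuous_comp _ _ _ (fun x : 'rV[R]_n => x 0 i0 ^+ 2)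
    (horner p)).
    by apply: continuous_exp_fun; exact: coord_continuous.
  exact: continuous_horner.
have c0 := witness_quad_gt0 R n2 k0.
have b0 := witness_lin_ge0 R k n2.
have disc := witness_disc R k0 kn n4.
have profE x : sphere R n x -> radial (witness k i0) x ^+ k =
  prof.[x 0 i0 ^+ 2].
  by move=> xS; exact: radial_pow.
have prof0 x : sphere R n x -> 0 <= prof.[x 0 i0 ^+ 2].
  by move=> xS; rewrite ltW// (profile_gt0 i0 c0 disc xS).
have g1 : grassmannian R n n (1%:M : 'M[R]_n).
  by split; [rewrite trmx1|rewrite mulmx1|rewrite mxrank1].
have n0 : (0 < n)%N by lia.
have S1 : sphere R n `&` subspace_of 1%:M = sphere R n.
  by apply/seteqP; split => x /=;
    [case|move=> xS; split => //; rewrite /subspace_of/= mulmx1].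
have : (\int[mu]_(P in grassmannian R n l) radon_transform h P)%R < 0.
  rewrite -dual; last by apply: continuous_subspaceT; exact: cpoly.
  rewrite (@density_integral _ _ (haar_sphere 1%:M) nu
    (fun x => prof.[x 0 i0 ^+ 2]))//.
  - under eq_Rintegral do rewrite -hornerM.
    have := @radon_horner n 1%:M i0 (test_poly * prof) n0 g1.
    rewrite /radon_transform S1 => ->.
    rewrite (_ : moment_functional _ _ =
      moment_functional (moment R n) (test_poly * prof)).
      rewrite test_profile_functional subr_lt0.
      have := @beta_functional_neg R l k l0 k0 (n ^ 2).
      by rewrite -nE; apply.
    by apply: eq_bigr => j _; rewrite mxE eqxx expr1n mulr1.
  - move=> A mA; rewrite dens//; apply: eq_integral => x; rewrite inE =>
      -[xS _].
    by rewrite profE.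
  - exact: cpoly.
rewrite ltNge => /negP; apply; apply: Rintegral_ge0 => P gP.
exact: radon_test_ge0.
Qed.

End not_busemann_petty.

Theorem theorem1p1 (R : realType) (n k : nat)
    (hn : (4 <= n)%N) (hk2 : (2 <= k)%N) (hkn : (k <= n - 2)%N) :
  exists K : set 'rV[R]_n,
    [/\ star_body K,
        infinitely_smooth K,
        body_of_revolution K,
        intersection_bodies R n k K &
        ~ busemann_petty_bodies R n k K].
Proof.
have n0 : (0 < n)%N by lia.
exists (witness k (Ordinal n0)); split.
- exact: star_witness.
- exact: smooth_witness.
- exact: revolution_witness.
- exact: witness_intersection_bodies.
- exact: witness_not_busemann_petty.
Qed.
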